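(* Consider a temporal graph $\mathcal{G}$ on $M$ temporal edges. Unless the Strong Exponential Time Hypothesis (SETH) fails, there is no algorithm running in time $\tilde{O}(M^{2-\epsilon})$, for some $\epsilon>0$ (that is, for no $\epsilon>0$ does such an algorithm exist), that decides whether $\mathcal{G}$ is temporally connected; and the same holds for deciding whether $\mathcal{G}$ is temporally unilaterally connected. This holds both in the strict model and in the non-strict model.
   Context: A temporal graph (respectively, directed temporal graph) $\mathcal{G}=(G,\lambda)$ with lifetime $\tau$ consists of a graph (respectively, directed graph) $G$ together with a time-function $\lambda:E(G)\to 2^{[\tau]}$, where $[\tau]=\{1,\dots,\tau\}$; the edge $e$ is available exactly at the times in $\lambda(e)$. The number of temporal edges is $M=\sum_{e\in E(G)}|\lambda(e)|$. A temporal $u,v$-path is a $u,v$-path in $G$ traversing consecutive edges $e_1,\dots,e_q$ at times $t_1,\dots,t_q$, with $t_i\in\lambda(e_i)$ for every $i$, such that $t_1\le\dots\le t_q$ in the non-strict model, and $t_1<\dots<t_q$ in the strict model (the trivial path from a vertex to itself is allowed). We say that $u$ reaches $v$ if there is a temporal $u,v$-path. $\mathcal{G}$ is temporally connected if for all $u,v\in V(G)$, $u$ reaches $v$ and $v$ reaches $u$; it is temporally unilaterally connected if for all $u,v\in V(G)$, $u$ reaches $v$ or $v$ reaches $u$. The notation $\tilde{O}(\cdot)$ ignores polylogarithmic factors. SETH is the hypothesis that for every $\delta>0$ there is an integer $k$ such that $k$-SAT on $N$ variables cannot be solved in time $O(2^{(1-\delta)N})$. *)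

(* Defs.v *)
From mathcomp Require Import all_boot all_order all_algebra.
From mathcomp Require Import all_classical reals exp.

Set Implicit Arguments.
Unset Strict Implicit.
Unset Printing Implicit Defensive.

Import Order.TTheory GRing.Theory Num.Theory.

(** * Algorithms: random access machines with logarithmic cost

    The machine has directly addressed registers and a separate, indirectly
    addressed memory; both hold natural numbers of unbounded size.  An
    instruction is charged the bit lengths of the numbers and memory addresses
    it handles, so that running times agree with those of the word RAM up to
    factors polynomial in the word length. *)

Inductive instr : Type :=
  | Const (d c : nat)    (* reg d := c *)
  | Add (d a b : nat)    (* reg d := reg a + reg b *)
  | Sub (d a b : nat)    (* reg d := reg a - reg b, truncated at 0 *)
  | Mul (d a b : nat)    (* reg d := reg a * reg b *)
  | Div (d a b : nat)    (* reg d := reg a %/ reg b, which is 0 if reg b = 0 *)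
  | Read (d a : nat)     (* reg d := mem (reg a) *)
  | Write (a b : nat)    (* mem (reg a) := reg b *)
  | Jump (l : nat)
  | Jz (a l : nat).      (* jump to l if reg a = 0 *)

Definition program := seq instr.

Record state : Type := State { pc : nat; reg : nat -> nat; mem : nat -> nat }.

Definition set_reg (s : state) (d v : nat) : state :=
  State (pc s).+1 [eta reg s with d |-> v] (mem s).

Definition step (i : instr) (s : state) : state :=
  match i with
  | Const d c => set_reg s d c
  | Add d a b => set_reg s d (reg s a + reg s b)
  | Sub d a b => set_reg s d (reg s a - reg s b)
  | Mul d a b => set_reg s d (reg s a * reg s b)
  | Div d a b => set_reg s d (reg s a %/ reg s b)
  | Read d a => set_reg s d (mem s (reg s a))
  | Write a b => State (pc s).+1 (reg s) [eta mem s with reg s a |-> reg s b]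
  | Jump l => State l (reg s) (mem s)
  | Jz a l => State (if reg s a == 0 then l else (pc s).+1) (reg s) (mem s)
  end.

(* The length of the binary notation of n; in particular bits 0 = 1. *)
Definition bits (n : nat) : nat := (trunc_log 2 n).+1.

(* The register indices occurring in an instruction are constants of the
   program and are not charged for. *)
Definition cost (i : instr) (s : state) : nat :=
  match i with
  | Const _ c => bits c
  | Add _ a b | Sub _ a b | Mul _ a b | Div _ a b =>
      bits (reg s a) + bits (reg s b)
  | Read _ a => bits (reg s a) + bits (mem s (reg s a))
  | Write a b => bits (reg s a) + bits (reg s b)
  | Jump _ => 1
  | Jz a _ => bits (reg s a)
  end.

(* [exec P s c s']: started in s, the program P halts in s' at total cost c.
   A program halts when its program counter leaves the program. *)
Inductive exec (P : program) : state -> nat -> state -> Prop :=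
  | exec_halt s : onth P (pc s) = None -> exec P s 0 s
  | exec_step s i c s' : onth P (pc s) = Some i ->
      exec P (step i s) c s' -> exec P s (cost i s + c) s'.

(* The input word is in memory cells 0, 1, ..., and its length in register 0;
   everything else is 0. *)
Definition init (x : seq nat) : state :=
  State 0 [eta (fun=> 0) with 0 |-> size x] (nth 0 x).

Definition accepting (s : state) : Prop := reg s 0 != 0.

(* [enc i x]: the word x is an encoding of the instance i (an instance may have
   several ones). *)
Definition decides (I : Type) (enc : I -> seq nat -> Prop) (yes : I -> Prop)
    (P : program) : Prop :=
  forall i x, enc i x ->
    exists c s, exec P (init x) c s /\ (accepting s <-> yes i).

(** * k-SAT and SETH *)

Definition literal (N : nat) : Type := ('I_N * bool)%type.

(* A k-CNF formula is a set of clauses, each a set of at most k literals.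
   Without repetitions, its size is polynomial in the number of variables, so
   that it makes sense to bound running times in terms of the latter only. *)
Record kcnf (k : nat) : Type := KCNF {
  nvars : nat;
  clauses : seq (seq (literal nvars));
  clauses_uniq : uniq clauses;
  clauses_size : all (fun c => uniq c && (size c <= k)) clauses
}.

Definition satisfiable (k : nat) (phi : kcnf k) : Prop :=
  exists a : 'I_(nvars phi) -> bool,
    all (has (fun l => a l.1 == l.2)) (clauses phi).

Definition literal_code (N : nat) (l : literal N) : nat := (l.1 : nat).*2 + l.2.

Definition kcnf_enc (k : nat) (phi : kcnf k) (x : seq nat) : Prop :=
  x = nvars phi ::
      flatten [seq size c :: [seq literal_code l | l <- c] | c <- clauses phi].

Local Open Scope ring_scope.

(* k-SAT on N variables can be solved in time O(2^((1 - delta) N)). *)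
Definition ksat_solvable (R : realType) (k : nat) (delta : R) : Prop :=
  exists P : program,
    decides (@kcnf_enc k) (@satisfiable k) P /\
    exists (C : R) (N0 : nat), forall (phi : kcnf k) x c s,
      kcnf_enc phi x -> exec P (init x) c s -> (N0 <= nvars phi)%N ->
      c%:R <= C * 2 `^ ((1 - delta) * (nvars phi)%:R).

Definition SETH (R : realType) : Prop :=
  forall delta : R, 0 < delta -> exists k : nat, ~ ksat_solvable k delta.

Local Close Scope ring_scope.

(** * Temporal graphs *)

(* The underlying graph is simple and undirected, on the vertex set
   {0, ..., nv - 1}.  The element t of 'I_life stands for the time t + 1, and
   lam is only relevant on edges. *)
Record tgraph : Type := TGraph {
  nv : nat;
  life : nat;
  edges : {set {set 'I_nv}};
  lam : {set 'I_nv} -> {set 'I_life};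
  edges_card2 : forall e, e \in edges -> #|e| = 2
}.

Arguments lam : clear implicits.

(* The number M of temporal edges. *)
Definition ntedges (G : tgraph) : nat := \sum_(e in edges G) #|lam G e|.

Inductive model : Type := Strict | NonStrict.

Definition time_rel (m : model) : rel nat :=
  if m is Strict then ltn else leq.

(* A path from u is given by the list of its successive steps (w, t): the next
   vertex w and the time t at which the edge leading to it is traversed. *)
Fixpoint traverses (G : tgraph) (u : 'I_(nv G))
    (p : seq ('I_(nv G) * 'I_(life G))) : bool :=
  if p is (w, t) :: p' then
    [&& [set u; w] \in edges G, t \in lam G [set u; w] & traverses w p']
  else true.

Definition temporal_path (m : model) (G : tgraph) (u v : 'I_(nv G))
    (p : seq ('I_(nv G) * 'I_(life G))) : bool :=
  [&& traverses u p, uniq (u :: unzip1 p), last u (unzip1 p) == v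
    & sorted (time_rel m) [seq val t | t <- unzip2 p]].

Definition reaches (m : model) (G : tgraph) (u v : 'I_(nv G)) : Prop :=
  exists p, temporal_path m u v p.

Definition temporally_connected (m : model) (G : tgraph) : Prop :=
  forall u v : 'I_(nv G), reaches m u v /\ reaches m v u.

Definition temporally_unilaterally_connected (m : model) (G : tgraph) : Prop :=
  forall u v : 'I_(nv G), reaches m u v \/ reaches m v u.

(* A temporal graph is encoded by its number of vertices, its lifetime, and the
   list of its temporal edges, each once, in any order and orientation.  An edge
   that is never available is thus omitted, and the length of the encoding
   is 3M + 2. *)
Definition tgraph_enc (G : tgraph) (x : seq nat) : Prop :=
  exists s : seq ('I_(nv G) * 'I_(nv G) * 'I_(life G)),
    let s' := [seq ([set z.1.1; z.1.2], z.2) | z <- s] in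
    [/\ uniq s',
        forall e t, ((e, t) \in s') = (e \in edges G) && (t \in lam G e)
      & x = nv G :: life G ::
            flatten [seq [:: val z.1.1; val z.1.2; (val z.2).+1] | z <- s]].

Local Open Scope ring_scope.

(* The property yes of temporal graphs can be decided in time O~(M^a).  The
   numbers of vertices and the lifetime are not bounded in terms of M, and a
   single vertex name or time has about log n or log tau bits, so the
   polylogarithmic factor is one in the size M + n + tau of the input. *)
Definition solvable_in_softO (R : realType) (yes : tgraph -> Prop) (a : R) :
    Prop :=
  exists P : program,
    decides tgraph_enc yes P /\
    exists (C : R) (d M0 : nat), forall (G : tgraph) x c s,
      tgraph_enc G x -> exec P (init x) c s -> (M0 <= ntedges G)%N ->
      c%:R <= C * (ntedges G)%:R `^ a
              * ln (ntedges G + nv G + life G)%:R ^+ d.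

(* Main.v *)
(* Split the N variables of a k-CNF formula into two halves, and let x and y
   range over the 2 ^ (N / 2) assignments of either half.  The gadget graph has
   vertices VA x and VB y, a vertex VC j for every position j of the word encoding
   the formula, and vertices VP x j and VQ y j.  Its core consists of the walks
   VA x, VP x j, VC j, VQ y j, VB y at times 6, 7, 8, 9; the first edge is present
   if a clause that ends at position j has no literal made true by x, the last one
   likewise for y.  So VA x reaches VB y through the core iff x and y together
   falsify some clause, and this holds for all x and y iff the formula is
   unsatisfiable.  (With direct edges between VA x and VC j at equal times, VA x
   could visit several VC j in the non-strict model; hence VP and VQ.)

   Two hubs, used before and after the core, provide the reachabilities between all
   other pairs without creating new ones from VA x to VB y, by strict walks.  In
   the graph for temporal connectedness the hubs are moreover joined at times 5 and
   13; without these edges no VB y reaches a VA x, as the unilateral case needs.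

   The graph has 2 ^ (N / 2) poly(N) temporal edges, and an explicit program writes
   its encoding in about as many steps.  Running the assumed algorithm on it and
   negating the answer decides k-SAT in time O(2 ^ ((1 - delta) N)), with the same
   delta > 0 for all k. *)

From HB Require Import structures.
Require Import Defs.
From mathcomp Require Import all_boot all_order all_algebra.
From mathcomp Require Import all_classical reals exp.
From mathcomp Require Import zify ring lra.

Set Implicit Arguments.
Unset Strict Implicit.
Unset Printing Implicit Defensive.

Local Open Scope nat_scope.

(** * Structured programs for the random access machine *)

Lemma bits_mono m n : m <= n -> bits m <= bits n.
Proof. by move=> mn; rewrite /bits ltnS leq_trunc_log. Qed.

Lemma bits_gt0 n : 0 < bits n. Proof. by []. Qed.

Lemma bits_leP n b : 0 < b -> (bits n <= b) = (n < 2 ^ b).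
Proof.
case: b => // b _; rewrite /bits ltnS; apply/idP/idP => h.
  by apply: leq_trans (trunc_log_ltn n (isT : 1 < 2)) _; rewrite leq_exp2l.
case: n h => [|n] h; first by rewrite trunc_log0.
rewrite -ltnS -(ltn_exp2l _ _ (isT : 1 < 2)).
exact: leq_ltn_trans (trunc_logP (isT : 1 < 2) (isT : 0 < n.+1)) h.
Qed.

Lemma ltn_2bits n : n < 2 ^ bits n. Proof. by rewrite -bits_leP. Qed.

Lemma bitsM m n : bits (m * n) <= bits m + bits n.
Proof.
rewrite bits_leP ?addn_gt0 ?bits_gt0 // expnD.
by apply: ltn_mul; apply: ltn_2bits.
Qed.

Lemma bitsD m n : bits (m + n) <= bits m + bits n.
Proof.
rewrite bits_leP ?addn_gt0 ?bits_gt0 //.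
have := ltn_2bits m; have := ltn_2bits n.
rewrite -(prednK (bits_gt0 m)) -(prednK (bits_gt0 n)) expnD !expnS.
have := expn_gt0 2 (bits m).-1; have := expn_gt0 2 (bits n).-1; nia.
Qed.

Lemma bits_le n : bits n <= n.+1.
Proof. by rewrite bits_leP // (leq_trans (ltn_expl n (isT : 1 < 2))) // leq_exp2l. Qed.

(** Unlike [exec], a run need not end in a halted state, so that runs of code fragments can be
    chained inside a larger program. *)
Inductive msteps (P : program) : state -> nat -> state -> Prop :=
  | msteps_refl s : msteps P s 0 s
  | msteps_step s i c s' : onth P (pc s) = Some i ->
      msteps P (step i s) c s' -> msteps P s (cost i s + c) s'.

Lemma msteps_trans P s c s' c' s'' :
  msteps P s c s' -> msteps P s' c' s'' -> msteps P s (c + c') s''.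
Proof.
by elim=> // {}s i {}c {}s' Pi _ IH /IH; rewrite -addnA; apply: msteps_step.
Qed.

Lemma msteps1 P s i : onth P (pc s) = Some i -> msteps P s (cost i s) (step i s).
Proof. by move=> Pi; rewrite -[cost i s]addn0; apply: msteps_step Pi (msteps_refl _ _). Qed.

Lemma msteps_exec P s c s' c' s'' :
  msteps P s c s' -> exec P s' c' s'' -> exec P s (c + c') s''.
Proof.
by elim=> // {}s i {}c {}s' Pi _ IH /IH; rewrite -addnA; apply: exec_step.
Qed.

(** Transfers a time bound proved for one run to every run, as [ksat_solvable] demands. *)
Lemma exec_det P s c s' c' s'' :
  exec P s c s' -> exec P s c' s'' -> c = c' /\ s' = s''.
Proof.
move=> e; elim: e c' s'' => [{}s Ps|{}s i {}c {}s' Pi _ IH] c' s'' e'.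
  by case: e' Ps => // {}s i {}c' {}s'' ->.
case: e' Pi IH => [{}s ->|{}s i' {}c' {}s'' ->] // e' [<-] IH.
by case: (IH _ _ e') => -> ->.
Qed.

(** Every instruction is charged at least the bit length of the number it puts into a register. This
    bounds the cost of testing the answer of a program. *)
Lemma exec_bits_reg P s c s' r : exec P s c s' -> bits (reg s' r) <= bits (reg s r) + c.
Proof.
elim=> [{}s _|{}s i {}c {}s' _ _ IH]; first by rewrite addn0.
apply: leq_trans IH _; rewrite addnA leq_add2r.
case: i => [d k|d a b|d a b|d a b|d a b|d a|a b|l|a l] //=; rewrite ?leq_addr //;
  case: eqP => _; rewrite ?leq_addr //.
- by rewrite leq_addl.
- by rewrite (leq_trans (bitsD _ _)) // leq_addl.
- by rewrite (leq_trans (bits_mono (leq_subr _ _))) // addnCA leq_addr.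
- by rewrite (leq_trans (bitsM _ _)) // leq_addl.
- by rewrite (leq_trans (bits_mono (leq_div _ _))) // addnCA leq_addr.
- by rewrite addnA leq_addl.
Qed.

(* A block is a sequence of instructions other than jumps; If r c1 c2 executes c1
   when register r is nonzero. *)
Inductive cmd : Type :=
  | Blk of seq instr
  | Seq of cmd & cmd
  | If of nat & cmd & cmd
  | While of nat & cmd.

Fixpoint csize (c : cmd) : nat :=
  match c with
  | Blk ins => size ins
  | Seq c1 c2 => csize c1 + csize c2
  | If _ c1 c2 => (csize c1 + csize c2).+2
  | While _ c1 => (csize c1).+2
  end.

Fixpoint comp (l : nat) (c : cmd) : program :=
  match c with
  | Blk ins => ins
  | Seq c1 c2 => comp l c1 ++ comp (l + csize c1) c2
  | If r c1 c2 =>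
      Jz r (l + (csize c1).+2) :: comp l.+1 c1 ++
      Jump (l + (csize c1 + csize c2).+2) :: comp (l + (csize c1).+2) c2
  | While r c1 =>
      Jz r (l + (csize c1).+2) :: rcons (comp l.+1 c1) (Jump l)
  end.

Lemma size_comp l c : size (comp l c) = csize c.
Proof.
elim: c l => //= [c1 IH1 c2 IH2|r c1 IH1 c2 IH2|r c1 IH1] l.
- by rewrite size_cat IH1 IH2.
- by rewrite size_cat /= IH1 IH2 addnS.
- by rewrite size_rcons IH1.
Qed.

Lemma comp_seq l c1 c2 : comp l (Seq c1 c2) = comp l c1 ++ comp (l + csize c1) c2.
Proof. by []. Qed.

Lemma comp_if l r c1 c2 : comp l (If r c1 c2) =
  Jz r (l + (csize c1).+2) :: comp l.+1 c1 ++
  Jump (l + (csize c1 + csize c2).+2) :: comp (l + (csize c1).+2) c2.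
Proof. by []. Qed.

Lemma comp_while l r c : comp l (While r c) =
  Jz r (l + (csize c).+2) :: rcons (comp l.+1 c) (Jump l).
Proof. by []. Qed.

(* The registers beyond the end of the list are 0. *)
Definition astate : Type := (seq nat * (nat -> nat))%type.

Definition conc (l : nat) (s : astate) : state := State l (nth 0 s.1) s.2.

Definition straight (i : instr) : bool :=
  match i with Jump _ | Jz _ _ => false | _ => true end.

Definition aexec (s : astate) (i : instr) : astate :=
  let: (rs, m) := s in
  match i with
  | Const d c => (set_nth 0 rs d c, m)
  | Add d a b => (set_nth 0 rs d (nth 0 rs a + nth 0 rs b), m)
  | Defs.Sub d a b => (set_nth 0 rs d (nth 0 rs a - nth 0 rs b), m)
  | Mul d a b => (set_nth 0 rs d (nth 0 rs a * nth 0 rs b), m)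
  | Div d a b => (set_nth 0 rs d (nth 0 rs a %/ nth 0 rs b), m)
  | Read d a => (set_nth 0 rs d (m (nth 0 rs a)), m)
  | Write a b => (rs, [eta m with nth 0 rs a |-> nth 0 rs b] : nat -> nat)
  | _ => s
  end.

Lemma step_conc l s i : straight i -> step i (conc l s) = conc l.+1 (aexec s i).
Proof.
by case: s => rs m; case: i => //= *; rewrite /set_reg /conc /=; congr State;
  apply/funext=> j; rewrite nth_set_nth.
Qed.

(** Only numbers that are charged for are bounded; the result of an arithmetic instruction may
    exceed [V] until it is used. *)
Definition fits (V : nat) (s : astate) (i : instr) : bool :=
  let: (rs, m) := s in
  match i with
  | Const _ c => c <= V
  | Add _ a b | Defs.Sub _ a b | Mul _ a b | Div _ a b | Write a b =>
      (nth 0 rs a <= V) && (nth 0 rs b <= V)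
  | Read _ a => (nth 0 rs a <= V) && (m (nth 0 rs a) <= V)
  | _ => true
  end.

Fixpoint fits_all (V : nat) (s : astate) (ins : seq instr) : bool :=
  if ins is i :: ins' then fits V s i && fits_all V (aexec s i) ins' else true.

(** An instruction is charged for at most two numbers. *)
Definition unit_cost (V : nat) : nat := (bits V).*2.

Lemma cost_fits V l s i : straight i -> fits V s i -> cost i (conc l s) <= unit_cost V.
Proof.
case: s => rs m; rewrite /unit_cost -addnn.
case: i => //= [d k|d a b|d a b|d a b|d a b|d a|a b] _; last first;
  try by case/andP=> h1 h2; apply: leq_add; apply: bits_mono.
by move=> /bits_mono h; apply: leq_trans h _; rewrite leq_addr.
Qed.

(* Time is counted in units that pay for one instruction on numbers <= V. *)
Definition runs (V T : nat) (c : cmd) (s s' : astate) : Prop :=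
  forall P1 P2, exists2 k, k <= T * unit_cost V &
    msteps (P1 ++ comp (size P1) c ++ P2) (conc (size P1) s) k
           (conc (size P1 + csize c) s').

Lemma onth_cat_r (T : Type) (s1 s2 : seq T) n : onth (s1 ++ s2) (size s1 + n) = onth s2 n.
Proof. by rewrite onth_cat ltnNge leq_addr addKn. Qed.

Lemma onth_size_cat (T : Type) (s1 s2 : seq T) : onth (s1 ++ s2) (size s1) = ohead s2.
Proof. by rewrite -[size s1]addn0 onth_cat_r; case: s2. Qed.

Lemma runs_weaken V T T' c s s' : T <= T' -> runs V T c s s' -> runs V T' c s s'.
Proof.
move=> TT' r P1 P2; have [k kT e] := r P1 P2; exists k => //.
by apply: leq_trans kT _; rewrite leq_mul2r TT' orbT.
Qed.

(** Each half runs with the code of the other as part of its context. *)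
Lemma runs_seq V T1 T2 c1 c2 s s' s'' :
  runs V T1 c1 s s' -> runs V T2 c2 s' s'' -> runs V (T1 + T2) (Seq c1 c2) s s''.
Proof.
move=> r1 r2 P1 P2; have [k1 k1T e1] := r1 P1 (comp (size P1 + csize c1) c2 ++ P2).
have [k2 k2T e2] := r2 (P1 ++ comp (size P1) c1) P2.
rewrite size_cat size_comp -catA in e2.
exists (k1 + k2); first by rewrite mulnDl leq_add.
by rewrite comp_seq -catA [csize _]/= addnA; apply: msteps_trans e1 e2.
Qed.

Lemma runs_blk V ins s :
  all straight ins -> fits_all V s ins -> runs V (size ins) (Blk ins) s (foldl aexec s ins).
Proof.
move=> + + P1 P2; elim: ins s P1 => [|i ins IH] s P1 /=.
  by move=> _ _; exists 0 => //; rewrite addn0; apply: msteps_refl.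
case/andP=> sti stis /andP[fi fis].
have [k kT e] := IH (aexec s i) (rcons P1 i) stis fis.
exists (cost i (conc (size P1) s) + k).
  by rewrite mulSn leq_add // cost_fits.
apply: msteps_step; first by rewrite /= onth_size_cat.
rewrite step_conc //; move: e; rewrite size_rcons cat_rcons /= addSnnS.
exact.
Qed.

Lemma cost_jz V r l l' s : nth 0 s.1 r <= V -> cost (Jz r l) (conc l' s) <= unit_cost V.
Proof.
by move=> h; apply: leq_trans (bits_mono h) _; rewrite /unit_cost -addnn leq_addr.
Qed.

Lemma unit_cost_gt0 V : 0 < unit_cost V. Proof. by rewrite double_gt0. Qed.

(** The two extra units pay for the test and for the jump over [c2] after [c1]. *)
Lemma runs_if V T r c1 c2 s s' : nth 0 s.1 r <= V ->
  (if nth 0 s.1 r == 0 then runs V T c2 s s' else runs V T c1 s s') ->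
  runs V T.+2 (If r c1 c2) s s'.
Proof.
move=> rV; case: eqP => r0 h P1 P2.
  have [k kT e] := h (P1 ++ Jz r (size P1 + (csize c1).+2) :: comp (size P1).+1 c1
    ++ [:: Jump (size P1 + (csize c1 + csize c2).+2)]) P2.
  exists (cost (Jz r (size P1 + (csize c1).+2)) (conc (size P1) s) + k).
    by rewrite mulSn leq_add ?(cost_jz _ _ rV) // (leq_trans kT) // leq_mul2r leqnSn orbT.
  apply: msteps_step; first by rewrite /= onth_size_cat.
  rewrite comp_if !cat_cons -!catA !cat_cons /= r0 eqxx; move: e.
  rewrite !size_cat /= !size_cat size_comp /= addn1 -!catA !cat_cons -!catA !cat_cons.
  by rewrite cat0s -addnA !addSn !addnS.
have [k kT e] := h (rcons P1 (Jz r (size P1 + (csize c1).+2)))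
  (Jump (size P1 + (csize c1 + csize c2).+2) :: comp (size P1 + (csize c1).+2) c2 ++ P2).
rewrite size_rcons cat_rcons in e.
exists (cost (Jz r (size P1 + (csize c1).+2)) (conc (size P1) s) + (k + 1)).
  rewrite mulSn leq_add ?(cost_jz _ _ rV) // mulSn addnC leq_add // unit_cost_gt0.
apply: msteps_step; first by rewrite /= onth_size_cat.
rewrite /= (introF eqP r0) -catA /=; apply: msteps_trans e _.
apply: (@msteps1 _ _ (Jump (size P1 + (csize c1 + csize c2).+2))).
by rewrite [pc _]/= addSnnS onth_cat_r /= -(size_comp (size P1).+1 c1) onth_size_cat.
Qed.

(** [S i] is the state after [i] rounds. Each round pays for its test and the jump back, and the
    last unit for the failing test. *)
Lemma runs_while V T r c (S : nat -> astate) n :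
  (forall i, i < n -> 0 < nth 0 (S i).1 r <= V /\ runs V T c (S i) (S i.+1)) ->
  nth 0 (S n).1 r = 0 ->
  runs V (n * T.+2).+1 (While r c) (S 0) (S n).
Proof.
move=> h r0 P1 P2; set W := _ ++ _; set l := size P1.
have Wl : onth W l = Some (Jz r (l + (csize c).+2)) by rewrite onth_size_cat.
have We : onth W (l.+1 + csize c) = Some (Jump l).
  by rewrite addSnnS onth_cat_r /= cat_rcons -(size_comp l.+1 c) onth_size_cat.
have [k kT e] : exists2 k, k <= n * T.+2 * unit_cost V &
    msteps W (conc l (S 0)) k (conc l (S n)).
  elim: n h {r0} => [|n IH] h; first by exists 0 => //; apply: msteps_refl.
  have [k kT e] := IH (fun i lin => h i (ltnW lin)).
  have [/andP[r0 rV] rn] := h n (ltnSn n).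
  have [k' k'T e'] := rn (rcons P1 (Jz r (l + (csize c).+2))) (Jump l :: P2).
  rewrite size_rcons cat_rcons in e'.
  exists (k + (cost (Jz r (l + (csize c).+2)) (conc l (S n)) + (k' + 1))).
    rewrite mulSnr mulnDl leq_add //= mulSn leq_add ?(cost_jz _ _ rV) //.
    by rewrite mulSn addnC leq_add // unit_cost_gt0.
  apply: msteps_trans e _; apply: msteps_step; first exact: Wl.
  rewrite /= eqn0Ngt r0 /=.
  have WE : W = P1 ++ Jz r (l + (csize c).+2) :: comp l.+1 c ++ Jump l :: P2.
    by rewrite /W comp_while cat_cons cat_rcons.
  rewrite -WE in e'; apply: msteps_trans e' _.
  exact: (@msteps1 _ _ (Jump l)).
exists (k + cost (Jz r (l + (csize c).+2)) (conc l (S n))).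
  by rewrite mulSnr leq_add // (cost_jz _ _ (_ : _ <= V)) // r0.
apply: msteps_trans e _; have := msteps1 (_ : onth W (pc (conc l (S n))) = _).
by move=> /(_ _ Wl); rewrite /= r0.
Qed.

(** * Temporal graphs given by lists of triples *)

Section TripleGraph.

Variables (nv' lf : nat) (T : seq (nat * nat * nat)).

Definition ord_triple (z : nat * nat * nat) : 'I_nv'.+1 * 'I_nv'.+1 * 'I_lf.+1 :=
  (inord z.1.1, inord z.1.2, inord z.2).

Definition tedges : seq ({set 'I_nv'.+1} * 'I_lf.+1) :=
  [seq ([set z.1.1; z.1.2], z.2) | z <- map ord_triple T].

(** The cardinality test provides the field [edges_card2] for every list [T]. *)
Definition triple_edges : {set {set 'I_nv'.+1}} :=
  [set e : {set 'I_nv'.+1} | (#|e| == 2) && [exists t, (e, t) \in tedges]].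

Lemma triple_edges_card2 e : e \in triple_edges -> #|e| = 2.
Proof. by rewrite inE => /andP[/eqP]. Qed.

Definition triple_graph : tgraph :=
  @TGraph nv'.+1 lf.+1 triple_edges (fun e => [set t | (e, t) \in tedges])
    triple_edges_card2.

(** With the larger endpoint first an edge has only one orientation, so distinct triples are
    distinct temporal edges. *)
Definition wf_triple (z : nat * nat * nat) : bool :=
  [&& z.1.2 < z.1.1, z.1.1 < nv'.+1 & z.2 < lf.+1].

Hypothesis wfT : {in T, forall z, wf_triple z}.
Hypothesis uniqT : uniq T.

Lemma ord_pair_eq u w u' w' : w < u < nv'.+1 -> w' < u' < nv'.+1 ->
  [set inord u; inord w] = [set inord u'; inord w'] :> {set 'I_nv'.+1} ->
  u = u' /\ w = w'.
Proof.
move=> /andP[wu ub] /andP[wu' ub'] e.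
have wb := ltn_trans wu ub; have wb' := ltn_trans wu' ub'.
have eqE i j : i < nv'.+1 -> j < nv'.+1 -> (inord i == inord j :> 'I_nv'.+1) = (i == j).
  by move=> ib jb; rewrite -val_eqE /= !inordK.
have := set21 (inord u : 'I_nv'.+1) (inord w); rewrite e !inE !eqE //.
have := set22 (inord u : 'I_nv'.+1) (inord w); rewrite e !inE !eqE //.
have := set21 (inord u' : 'I_nv'.+1) (inord w'); rewrite -e !inE !eqE //.
have := set22 (inord u' : 'I_nv'.+1) (inord w'); rewrite -e !inE !eqE //.
lia.
Qed.

Lemma uniq_tedges : uniq tedges.
Proof.
rewrite /tedges -map_comp map_inj_in_uniq // => -[[u w] t] [[u' w'] t'] /wfT.
move=> /and3P[/= wu ub tb] /wfT/and3P[/= wu' ub' tb'] [e et].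
have [-> ->] : u = u' /\ w = w'.
  by apply: ord_pair_eq e; rewrite ?wu ?wu' ?ub ?ub'.
by move/(congr1 val): et; rewrite /= !inordK // => ->.
Qed.

Lemma card_tedges e t : (e, t) \in tedges -> #|e| = 2.
Proof.
rewrite /tedges -map_comp => /mapP[[[u w] t'] /wfT/and3P[/= wu ub _] [-> _]].
rewrite cards2 -val_eqE /= !inordK //; last exact: ltn_trans wu ub.
by rewrite gtn_eqF.
Qed.

Lemma triple_edgesE e t :
  (e \in edges triple_graph) && (t \in lam triple_graph e) = ((e, t) \in tedges).
Proof.
rewrite !inE; case: (boolP ((e, t) \in tedges)) => et; last by rewrite andbF.
by rewrite (card_tedges et) andbT; apply/existsP; exists t.
Qed.

Lemma tgraph_enc_triple :
  tgraph_enc triple_graph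
    (nv'.+1 :: lf.+1 :: flatten [seq [:: z.1.1; z.1.2; z.2.+1] | z <- T]).
Proof.
exists (map ord_triple T); split; first exact: uniq_tedges.
- by move=> e t; rewrite triple_edgesE.
- congr (_ :: _ :: flatten _); rewrite -map_comp; apply/eq_in_map => -[[u w] t].
  move=> /wfT/and3P[/= wu ub tb]; rewrite !inordK //; exact: ltn_trans wu ub.
Qed.

Lemma ntedges_triple : ntedges triple_graph = size T.
Proof.
rewrite /ntedges; have -> : size T = #|[set z in tedges]|.
  by rewrite cardsE (card_uniqP uniq_tedges) !size_map.
rewrite -sum1_card.
under eq_bigr do rewrite -sum1_card.
rewrite pair_big_dep /=; apply: eq_bigl => -[e t].
by rewrite [RHS]inE -triple_edgesE.
Qed.

Lemma triple_adj (u w : 'I_nv'.+1) (t : 'I_lf.+1) :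
  ([set u; w] \in edges triple_graph) && (t \in lam triple_graph [set u; w]) =
  ((val u, val w, val t) \in T) || ((val w, val u, val t) \in T).
Proof.
have h (x y : 'I_nv'.+1) : (val x, val y, val t) \in T -> ([set x; y], t) \in tedges.
  move=> xyT; rewrite /tedges -map_comp; apply/mapP.
  by exists (val x, val y, val t) => //=; rewrite !inord_val.
rewrite triple_edgesE; apply/idP/orP => [|[/h //|/h]]; last by rewrite finset.setUC.
rewrite /tedges -map_comp => /mapP[[[x y] t'] xyT [e et]].
have /and3P[/= yx xb tb] := wfT xyT; have yb := ltn_trans yx xb.
have t't : t' = t by move/(congr1 val): et; rewrite /= inordK.
rewrite -t't -[val u]/(u : nat) -[val w]/(w : nat).
have := set21 u w; rewrite e !inE -!val_eqE /= !inordK // => hu.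
have := set22 u w; rewrite e !inE -!val_eqE /= !inordK // => hw.
have := set21 (inord x) (inord y : 'I_nv'.+1); rewrite -e !inE -!val_eqE /= !inordK // => hx.
have := set22 (inord x) (inord y : 'I_nv'.+1); rewrite -e !inE -!val_eqE /= !inordK // => hy.
have [[-> ->]|[-> ->]] : (u = x :> nat /\ w = y :> nat) \/ (u = y :> nat /\ w = x :> nat) by lia.
- by left.
- by right.
Qed.

End TripleGraph.

(** * Temporal walks *)

Lemma path_suffix (G : tgraph) (u w : 'I_(nv G)) (q : seq ('I_(nv G) * 'I_(life G))) :
  traverses w q -> uniq (w :: unzip1 q) -> u \in w :: unzip1 q ->
  exists r, [/\ traverses u r, uniq (u :: unzip1 r),
    last u (unzip1 r) = last w (unzip1 q) & subseq (unzip2 r) (unzip2 q)].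
Proof.
elim: q w => [|[w' t'] q IH] w tq uq; rewrite in_cons => /predU1P[->|].
- by exists [::].
- by [].
- by exists ((w', t') :: q).
- move: tq uq => /and3P[_ _ tq] /andP[_ uq] /(IH _ tq uq)[r [tr ur lr sr]].
  exists r; split=> //; apply: subseq_trans sr _.
  exact: subseq_cons.
Qed.

(** Loops can be cut out of a walk: the remaining times form a subsequence, which is still sorted
    because [time_rel m] is transitive. *)
Lemma walk_path (m : model) (G : tgraph) (u : 'I_(nv G)) p :
  traverses u p -> sorted (time_rel m) [seq val t | t <- unzip2 p] ->
  reaches m u (last u (unzip1 p)).
Proof.
have tr : transitive (time_rel m) by case: m => y x z /=; lia.
move=> tp sp; suff: exists q, [/\ traverses u q, uniq (u :: unzip1 q),
    last u (unzip1 q) = last u (unzip1 p) & subseq (unzip2 q) (unzip2 p)].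
  case=> q [tq uq lq sq]; exists q; rewrite /temporal_path tq uq lq eqxx /=.
  by apply: subseq_sorted sp => //; apply: map_subseq.
elim: p u tp {sp} => [|[w t] p IH] u /=; first by exists [::].
case/and3P=> uw tuw /IH[q [tq uq lq sq]].
case: (boolP (u \in w :: unzip1 q)) => [uin|unin].
  have [r [tr' ur lr sr]] := path_suffix tq uq uin.
  exists r; split=> //; first by rewrite lr.
  exact: subseq_trans (subseq_trans sr sq) (subseq_cons _ _).
exists ((w, t) :: q); split=> //.
- by rewrite /= uw tuw.
- by rewrite cons_uniq unin.
- by rewrite /= eqxx.
Qed.

(** * The gadget graph *)

Inductive vert : Type :=
  | Hub | LateHub
  | VC of nat
  | VA of nat
  | VB of nat
  | VP of nat & nat
  | VQ of nat & nat.

Definition vert_code (v : vert) : nat * nat * nat :=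
  match v with
  | Hub => (0, 0, 0)
  | LateHub => (1, 0, 0)
  | VC j => (2, 0, j)
  | VA x => (3, x, 0)
  | VB x => (4, x, 0)
  | VP x j => (5, x, j)
  | VQ x j => (6, x, j)
  end.

Definition vert_decode (z : nat * nat * nat) : vert :=
  let: (k, x, j) := z in
  match k with
  | 0 => Hub | 1 => LateHub | 2 => VC j | 3 => VA x | 4 => VB x
  | 5 => VP x j | _ => VQ x j
  end.

Lemma vert_codeK : cancel vert_code vert_decode. Proof. by case. Qed.

HB.instance Definition _ := Equality.copy vert (can_type vert_codeK).

Section Gadget.

Variables (K n : nat) (fA fB : nat -> nat -> bool) (conn : bool).

(** The hubs and the [VC j] come first, followed by rows of [K.+1.*2] vertices: [VA x], [VB x] and
    the [K] pairs [VP x j], [VQ x j]. Row [x] starts at [base x]. *)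
Definition base (x : nat) : nat := K.+2 + x * K.+1.*2.

Definition num (v : vert) : nat :=
  match v with
  | Hub => 0
  | LateHub => 1
  | VC j => j.+2
  | VA x => base x
  | VB x => (base x).+1
  | VP x j => base x + j.+1.*2
  | VQ x j => base x + j.+1.*2.+1
  end.

(* [(w, t) \in down v]: there is an edge at time t from v to the vertex w, which
   has a smaller number.  An edge missing from the core is replaced by a harmless
   one to Hub, whose number is 0: the program computes the endpoint as a product. *)
Definition down (v : vert) : seq (vert * nat) :=
  match v with
  | Hub => [::]
  | LateHub => (Hub, 0) :: if conn then [:: (Hub, 5); (Hub, 13)] else [::]
  | VC j => [:: (Hub, 1); (Hub, 2); (LateHub, 12)]
  | VA x => [:: (LateHub, 10); (LateHub, 11)]
  | VB x => [:: (Hub, 3); (Hub, 4)]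
  | VP x j => [:: (Hub, 1); (Hub, 2); (if fA x j then VA x else Hub, 6);
                  (VC j, 7); (LateHub, 12)]
  | VQ x j => [:: (Hub, 1); (Hub, 2); (VC j, 8);
                  (if fB x j then VB x else Hub, 9); (LateHub, 12)]
  end.

Definition row_verts (x : nat) : seq vert :=
  [:: VA x, VB x & flatten [seq [:: VP x j; VQ x j] | j <- iota 0 K]].

Definition verts : seq vert :=
  [:: Hub, LateHub & map VC (iota 0 K)] ++ flatten (map row_verts (iota 0 n)).

Definition nverts' : nat := K.+1 + n * K.+1.*2.

Lemma num_pairs x m :
  map num (flatten [seq [:: VP x j; VQ x j] | j <- iota 0 m]) = iota (base x).+2 m.*2.
Proof.
elim: m => // m IH; rewrite -{1}(addn1 m) iotaD map_cat flatten_cat map_cat IH add0n.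
rewrite doubleS -[m.*2.+2]addn2 iotaD; congr cat => /=.
by congr [:: _; _]; lia.
Qed.

Lemma num_rows m :
  map num (flatten (map row_verts (iota 0 m))) = iota K.+2 (m * K.+1.*2).
Proof.
elim: m => // m IH; rewrite -{1}(addn1 m) iotaD map_cat flatten_cat map_cat IH add0n.
by rewrite mulSnr iotaD; congr cat; rewrite /= cats0 num_pairs.
Qed.

(** [verts] lists the vertices by increasing number, so [num] is a bijection from the valid vertices
    to an initial segment, with inverse [vert_at]. *)
Lemma num_verts : map num verts = iota 0 nverts'.+1.
Proof.
have -> : nverts'.+1 = K.+2 + n * K.+1.*2 by [].
rewrite /verts map_cat num_rows iotaD add0n; congr cat; rewrite /= -map_comp.
have -> : iota 2 K = map (fun j => j.+2) (iota 0 K) by rewrite -[2]addn0 iotaDl.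
by congr [:: _, _ & _]; apply: eq_map.
Qed.

Definition valid (v : vert) : bool :=
  match v with
  | Hub | LateHub => true
  | VC j => j < K
  | VA x | VB x => x < n
  | VP x j | VQ x j => (x < n) && (j < K)
  end.

Lemma mem_verts v : (v \in verts) = valid v.
Proof.
rewrite /verts mem_cat !in_cons.
have rowP : reflect (exists2 x, x < n & v \in row_verts x)
    (v \in flatten (map row_verts (iota 0 n))).
  apply: (iffP flatten_mapP) => -[x]; first by rewrite mem_iota => xn; exists x.
  by move=> xn vx; exists x; rewrite ?mem_iota.
have pairP x : reflect (exists2 j, j < K & (v == VP x j) || (v == VQ x j))
    (v \in flatten [seq [:: VP x j; VQ x j] | j <- iota 0 K]).
  apply: (iffP flatten_mapP) => -[j]; rewrite ?mem_iota => jK.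
    by rewrite !inE => ?; exists j.
  by move=> ?; exists j; rewrite ?mem_iota ?inE.
apply/idP/idP.
  case/orP => [/or3P[/eqP->|/eqP->|/mapP[j]]|/rowP[x xn]] //.
    by rewrite mem_iota => jK ->.
  rewrite !in_cons => /or3P[/eqP->|/eqP->|/pairP[j jK /orP[]/eqP->]] //=;
  by rewrite xn.
move=> vv; apply/orP; case: v vv rowP pairP => [||j|x|x|x j|x j] //= vv rowP pairP.
- by left.
- by left.
- by left; apply: map_f; rewrite mem_iota.
- by right; apply/rowP; exists x => //; rewrite inE eqxx.
- by right; apply/rowP; exists x => //; rewrite !inE eqxx orbT.
- case/andP: vv => xn jK; right; apply/rowP; exists x => //; rewrite !in_cons.
  by apply/or3P/Or33/pairP; exists j; rewrite ?eqxx.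
- case/andP: vv => xn jK; right; apply/rowP; exists x => //; rewrite !in_cons.
  by apply/or3P/Or33/pairP; exists j; rewrite ?eqxx ?orbT.
Qed.

Lemma size_verts : size verts = nverts'.+1.
Proof. by rewrite -(size_map num) num_verts size_iota. Qed.

Definition vert_at (u : nat) : vert := nth Hub verts u.

Lemma vert_atK u : u < nverts'.+1 -> num (vert_at u) = u.
Proof.
by move=> ub; rewrite -(nth_map _ 0) ?size_verts // num_verts nth_iota.
Qed.

Lemma valid_vert_at u : u < nverts'.+1 -> valid (vert_at u).
Proof. by move=> ub; rewrite -mem_verts mem_nth // size_verts. Qed.

Lemma num_lt v : valid v -> num v < nverts'.+1.
Proof.
by rewrite -mem_verts => /(map_f num); rewrite num_verts mem_iota.
Qed.

Lemma numK v : valid v -> vert_at (num v) = v.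
Proof.
rewrite -mem_verts => vin; have ib := vin; rewrite -index_mem in ib.
have := vert_atK (u := index v verts); rewrite -size_verts => /(_ ib).
by rewrite {1}/vert_at nth_index // => ->; rewrite /vert_at nth_index.
Qed.

Lemma valid_down v w t : valid v -> (w, t) \in down v -> valid w.
Proof.
case: v => [||j|x|x|x j|x j] //=; first by case: conn; rewrite !inE => _;
  repeat case/orP; do ?move=> /eqP[-> _] //.
- by rewrite !inE => _; repeat case/orP; move/eqP=> [-> _].
- by rewrite !inE => _; repeat case/orP; move/eqP=> [-> _].
- by rewrite !inE => _; repeat case/orP; move/eqP=> [-> _].
- rewrite !inE => /andP[? ?]; repeat case/orP; move/eqP=> [-> _] //; by case: ifP.
- rewrite !inE => /andP[? ?]; repeat case/orP; move/eqP=> [-> _] //; by case: ifP.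
Qed.

Lemma num_down v w t : valid v -> (w, t) \in down v -> num w < num v /\ t < 14.
Proof.
case: v => [||j|x|x|x j|x j] //=; first by case: conn; rewrite !inE => _;
  repeat case/orP; do ?move=> /eqP[-> ->] //.
- by rewrite !inE => _; repeat case/orP; move/eqP=> [-> ->].
- by rewrite !inE => _; repeat case/orP; move/eqP=> [-> ->].
- by rewrite !inE => _; repeat case/orP; move/eqP=> [-> ->].
- rewrite !inE => /andP[? ?]; repeat case/orP; move/eqP=> [-> ->] //=;
  do ?case: ifP => _ /=; rewrite /base; split=> //; lia.
- rewrite !inE => /andP[? ?]; repeat case/orP; move/eqP=> [-> ->] //=;
  do ?case: ifP => _ /=; rewrite /base; split=> //; lia.
Qed.

Definition triples_of (v : vert) : seq (nat * nat * nat) :=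
  [seq (num v, num e.1, e.2) | e <- down v].

Definition triples : seq (nat * nat * nat) := flatten (map triples_of verts).

Lemma triplesP u w t :
  reflect (exists v e, [/\ valid v, e \in down v, u = num v, w = num e.1 & t = e.2])
    ((u, w, t) \in triples).
Proof.
apply: (iffP flatten_mapP) => [[v]|[v [e [vv ev -> -> ->]]]].
  by rewrite mem_verts => vv /mapP[e ev [-> -> ->]]; exists v, e.
by exists v; rewrite ?mem_verts // map_f.
Qed.

Lemma wf_triples : {in triples, forall z, wf_triple nverts' 13 z}.
Proof.
case=> -[u w] t /triplesP[v [[w' t'] [vv wv -> -> ->]]]; rewrite /wf_triple /=.
by have [-> ->] := num_down vv wv; rewrite num_lt.
Qed.

(** Triples of one vertex differ in their times, those of different vertices in their first
    component. *)
Lemma uniq_triples : uniq triples.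
Proof.
have uv : uniq verts by apply: (@map_uniq _ _ num); rewrite num_verts iota_uniq.
rewrite /triples; have : {subset verts <= [pred v | valid v]}.
  by move=> v; rewrite mem_verts.
elim: verts uv => //= v s IH /andP[vs us] sv.
rewrite cat_uniq IH // ?andbT; last by move=> z zs; apply: sv; rewrite inE zs orbT.
apply/andP; split.
  apply: (@map_uniq _ _ snd); rewrite -map_comp.
  by case: v {vs sv} => //=; case: conn.
apply/hasPn => -[[u w] t] /flatten_mapP[z zs /mapP[e ez [-> _ _]]].
apply/mapP => -[e' _ [zv _ _]]; move: vs; suff <- : z = v by rewrite zs.
rewrite -(numK (sv z _)) ?inE ?zs ?orbT // zv numK //.
by apply: sv; rewrite inE eqxx.
Qed.

Definition gadget : tgraph := triple_graph nverts' 13 triples.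

Definition ord_of (v : vert) : 'I_(nv gadget) := inord (num v).

Lemma val_ord_of v : valid v -> val (ord_of v) = num v.
Proof. by move=> vv; apply: inordK; apply: num_lt. Qed.

Lemma ord_ofK (u : 'I_(nv gadget)) : ord_of (vert_at u) = u.
Proof. by rewrite /ord_of vert_atK // inord_val. Qed.

Lemma valid_ord (u : 'I_(nv gadget)) : valid (vert_at u).
Proof. exact: valid_vert_at. Qed.

Definition vedge (v w : vert) (t : nat) : bool :=
  ((w, t) \in down v) || ((v, t) \in down w).

Lemma gadget_adj (u w : 'I_(nv gadget)) (t : 'I_(life gadget)) :
  ([set u; w] \in edges gadget) && (t \in lam gadget [set u; w]) =
  vedge (vert_at u) (vert_at w) t.
Proof.
have h (x y : 'I_(nv gadget)) :
    ((val x, val y, val t) \in triples) = ((vert_at y, val t) \in down (vert_at x)).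
  apply/triplesP/idP => [[v [[v' t'] [vv ev xE yE /= ->]]]|xy].
    by rewrite xE yE /= !numK // (valid_down vv ev).
  exists (vert_at x), (vert_at y, val t); rewrite !vert_atK //.
  by split=> //; apply: valid_ord.
rewrite (triple_adj wf_triples); last exact: uniq_triples.
exact: (congr2 orb (h u w) (h w u)).
Qed.

Fixpoint vwalk (v : vert) (p : seq (vert * nat)) : bool :=
  if p is (w, t) :: p' then [&& valid w, vedge v w t, t < 14 & vwalk w p'] else true.

(** Strictly increasing times are admissible in both models. *)
Lemma vwalk_reaches m v p : valid v -> vwalk v p -> sorted ltn (unzip2 p) ->
  reaches m (ord_of v) (ord_of (last v (unzip1 p))).
Proof.
move=> vv vp sp.
pose q : seq ('I_(nv gadget) * 'I_(life gadget)) := [seq (ord_of e.1, inord e.2) | e <- p].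
have -> : ord_of (last v (unzip1 p)) = last (ord_of v) (unzip1 q).
  by rewrite -(last_map ord_of) /q /unzip1 -!map_comp; congr last; apply: eq_map.
apply: walk_path.
  rewrite {sp}/q; elim: p v vv vp => [|[w t] p IH] v vv //= /and4P[vw vwt tb wp].
  by rewrite (andbA (_ \in _)) gadget_adj IH // andbT !val_ord_of // !numK // inordK.
have <- : unzip2 p = [seq val t | t <- unzip2 q].
  rewrite /q /unzip2 -!map_comp; move: vp {sp q} => vp; apply/eq_in_map => -[w t] /=.
  elim: p v vv vp => [|[w' t'] p IH] v vv //= /and4P[vw' vwt tb wp].
  rewrite inE => /orP[/eqP[_ ->]|]; first by rewrite inordK.
  exact: IH wp.
by apply: sub_sorted sp => x y; case: m => //=; exact: ltnW.
Qed.

(** Read [I v t] as a superset of what is reached by time [t]. Edges are undirected, so [I] must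
    agree at both ends of an edge at its time. Such an [I] is kept even by several edges at equal
    times, which covers the non-strict model and hence the strict one. *)
Lemma gadget_invariant m (I : vert -> nat -> bool) v w :
  (forall a b t, valid a -> (b, t) \in down a -> I a t = I b t) ->
  (forall a s t, s <= t -> I a s -> I a t) ->
  valid v -> valid w -> I v 0 -> reaches m (ord_of v) (ord_of w) ->
  exists t, I w t.
Proof.
move=> Ie Im vv vw Iv [p /and4P[tp _ /eqP lp sp]].
have {}sp : path leq 0 [seq val t | t <- unzip2 p].
  have : sorted leq [seq val t | t <- unzip2 p].
    by apply: sub_sorted sp => x y; case: m => //=; exact: ltnW.
  by case: [seq val t | t <- unzip2 p].
have <- : vert_at (ord_of w) = w by rewrite val_ord_of // numK.
rewrite -lp; have {Iv} : I (vert_at (ord_of v)) 0 by rewrite val_ord_of // numK.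
elim: p (ord_of v) 0 tp sp {lp} => [|[u t] p IH] x s /=.
  by move=> _ _ ?; exists s.
rewrite andbA gadget_adj => /andP[xu tp] /andP[st sp] Ix; apply: IH tp sp _.
case/orP: xu => [/Ie <-|/Ie ->]; try exact: valid_ord; exact: Im Ix.
Qed.

End Gadget.

(** * Reachability in the gadget graph *)

Section GadgetReach.

Variables (K n : nat) (fA fB : nat -> nat -> bool).

(** The vectors [fA x] and [fB y] are not orthogonal, in the sense of the Orthogonal Vectors
    problem. *)
Definition meet (x y : nat) : bool := has (fun j => fA x j && fB y j) (iota 0 K).

Section Invariants.

Variables (conn : bool) (m : model).

Let G := gadget K n fA fB conn.
Let pt (v : vert) : 'I_(nv G) := ord_of K n fA fB conn v.

(* The vertices that VA x may reach by time t. *)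
Definition reach_from_A (x : nat) (v : vert) (t : nat) : bool :=
  match v with
  | Hub => 9 <= t
  | LateHub => 10 <= t
  | VC j => (12 <= t) || (7 <= t) && fA x j
  | VA x' => (x' == x) || (10 <= t)
  | VB y => (9 <= t) && meet x y
  | VP x' j => [|| 12 <= t, (7 <= t) && fA x j | [&& 6 <= t, x' == x & fA x j]]
  | VQ y j => [|| 12 <= t, (8 <= t) && fA x j | (9 <= t) && (~~ fB y j || meet x y)]
  end.

(* The vertices that some VB y may reach by time t, if conn = false. *)
Definition reach_from_B (v : vert) (t : nat) : bool :=
  match v with
  | Hub | VC _ | VQ _ _ => 3 <= t
  | LateHub => 12 <= t
  | VA _ => false
  | VB _ => true
  | VP x j => (3 <= t) && (fA x j ==> (7 <= t))
  end.

(** By [reach_from_A], [Hub] is not reached before time 9, too late for its edges to [VB] at times 3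
    and 4; so only the core remains. *)
Lemma VA_reaches_VB x y : x < n -> y < n -> reaches m (pt (VA x)) (pt (VB y)) -> meet x y.
Proof.
move=> xn yn xy; suff [t] : exists t, reach_from_A x (VB y) t by case/andP.
apply: (gadget_invariant _ _ _ _ _ xy) => //=; last by rewrite eqxx.
- move=> a b t; case: a => [||j|x'|y'|x' j|y' j] //=.
  + by case: conn; rewrite !inE => _; repeat case/orP; do ?move=> /eqP[-> ->] //.
  + by rewrite !inE => _; repeat case/orP; move=> /eqP[-> ->].
  + by rewrite !inE => _; repeat case/orP; move=> /eqP[-> ->] /=; rewrite !orbT.
  + by rewrite !inE => _; repeat case/orP; move=> /eqP[-> ->].
  + rewrite !inE => _; repeat case/orP; move=> /eqP[-> ->] //=.
      by case: ifP => //=; case: eqP => //= -> ->.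
    by case: (fA x j); rewrite ?andbF.
  + rewrite !inE => /andP[_ jK]; repeat case/orP; move=> /eqP[-> ->] //=.
      by rewrite orbF.
    case: ifP => fBj /=; rewrite ?orbT //.
    case: (boolP (fA x j)) => //= fAj; symmetry; apply/hasP; exists j.
      by rewrite mem_iota.
    by rewrite fAj.
- move=> [||j|x'|y'|x' j|y' j] s t st /=.
  + lia.
  + lia.
  + case: (fA x j) => /=; lia.
  + case: (x' == x) => /=; lia.
  + case: (meet x y') => /=; lia.
  + case: (fA x j) => /=; case: (x' == x) => /=; lia.
  + case: (fA x j) => /=; case: (_ || meet x y') => /=; lia.
Qed.

(** By [reach_from_B], [LateHub] is not reached before time 12, after its edges to [VA] at times 10
    and 11. A vertex [VP x j] joined to [VA x] at time 6 is not reached before time 7. *)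
Lemma VB_reaches_VA x y : conn = false -> x < n -> y < n ->
  ~ reaches m (pt (VB y)) (pt (VA x)).
Proof.
move=> cF xn yn yx; suff [t] : exists t, reach_from_B (VA x) t by [].
apply: (gadget_invariant _ _ _ _ _ yx) => //=.
- move=> a b t; case: a => [||j|x'|y'|x' j|y' j] //=.
  + by rewrite cF !inE => _ /eqP[-> ->].
  + by rewrite !inE => _; repeat case/orP; move=> /eqP[-> ->].
  + by rewrite !inE => _; repeat case/orP; move=> /eqP[-> ->].
  + by rewrite !inE => _; repeat case/orP; move=> /eqP[-> ->].
  + rewrite !inE => _; repeat case/orP; move=> /eqP[-> ->] //=;
    by case: (fA x' j).
  + rewrite !inE => _; repeat case/orP; move=> /eqP[-> ->] //=.
    by case: (fB y' j).
- move=> [||j|x'|y'|x' j|y' j] s t st /=; lia.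
Qed.

Definition vreach (v w : vert) : Prop := exists p,
  [/\ vwalk K n fA fB conn v p, sorted ltn (unzip2 p) & last v (unzip1 p) = w].

Lemma vreach_reaches v w : valid K n v -> vreach v w -> reaches m (pt v) (pt w).
Proof. by move=> vv [p [wp sp <-]]; apply: vwalk_reaches. Qed.

Lemma meet_vreach x y : x < n -> y < n -> meet x y -> vreach (VA x) (VB y).
Proof.
move=> xn yn /hasP[j]; rewrite mem_iota /= => jK /andP[Aj Bj].
exists [:: (VP x j, 6); (VC j, 7); (VQ y j, 8); (VB y, 9)].
by rewrite /= /vedge /= Aj Bj !inE !eqxx xn yn jK.
Qed.

End Invariants.

(** One strict walk for each ordered pair of kinds of vertices except [VA] to [VB]. The walks using
    time 5 or 13 exist for [conn = true] only; in the unilateral case the tactic fails on them and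
    the opposite direction is tried. *)
Ltac route := let q := match goal with
  | |- vreach _ Hub Hub => constr:(Nil (vert * nat))
  | |- vreach _ LateHub LateHub => constr:(Nil (vert * nat))
  | |- vreach _ Hub LateHub => constr:([:: (LateHub, 0)])
  | |- vreach _ LateHub Hub => constr:([:: (Hub, 0)])
  | |- vreach _ Hub (VA ?y) => constr:([:: (LateHub, 0); (VA y, 10)])
  | |- vreach _ Hub (VB ?y) => constr:([:: (VB y, 3)])
  | |- vreach _ Hub ?w => constr:([:: (w, 1)])
  | |- vreach _ LateHub (VA ?y) => constr:([:: (VA y, 10)])
  | |- vreach _ LateHub (VB ?y) => constr:([:: (Hub, 0); (VB y, 3)])
  | |- vreach _ LateHub ?w => constr:([:: (w, 12)])
  | |- vreach _ (VA _) Hub => constr:([:: (LateHub, 10); (Hub, 13)])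
  | |- vreach _ (VA _) LateHub => constr:([:: (LateHub, 10)])
  | |- vreach _ (VA _) (VA ?y) => constr:([:: (LateHub, 10); (VA y, 11)])
  | |- vreach _ (VA _) ?w => constr:([:: (LateHub, 10); (w, 12)])
  | |- vreach _ (VB _) Hub => constr:([:: (Hub, 3)])
  | |- vreach _ (VB _) LateHub => constr:([:: (Hub, 3); (LateHub, 5)])
  | |- vreach _ (VB _) (VA ?y) => constr:([:: (Hub, 3); (LateHub, 5); (VA y, 10)])
  | |- vreach _ (VB _) (VB ?y) => constr:([:: (Hub, 3); (VB y, 4)])
  | |- vreach _ (VB _) ?w => constr:([:: (Hub, 3); (LateHub, 5); (w, 12)])
  | |- vreach _ _ Hub => constr:([:: (Hub, 1)])
  | |- vreach _ _ LateHub => constr:([:: (LateHub, 12)])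
  | |- vreach _ _ (VA ?y) => constr:([:: (Hub, 1); (LateHub, 5); (VA y, 10)])
  | |- vreach _ _ (VB ?y) => constr:([:: (Hub, 1); (VB y, 3)])
  | |- vreach _ _ ?w => constr:([:: (Hub, 1); (w, 2)])
  end in by exists q; split=> //; rewrite /= /vedge /= ?inE ?eqxx ?orbT /= ?andbT.

Lemma connected_gadget m :
  temporally_connected m (gadget K n fA fB true) <->
  forall x y, x < n -> y < n -> meet x y.
Proof.
split=> [c x y xn yn|h u v].
  exact: (VA_reaches_VB xn yn (c _ _).1).
suff c (v1 v2 : vert) : valid K n v1 -> valid K n v2 ->
    reaches m (ord_of K n fA fB true v1) (ord_of K n fA fB true v2).
  by rewrite -(ord_ofK u) -(ord_ofK v); split; apply: c; apply: valid_ord.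
move=> V1 V2; apply: vreach_reaches => //.
case: v1 V1 => [||i|x|x|x i|x i] /= V1; case: v2 V2 => [||j|y|y|y j|y j] /= V2.
all: try (apply: meet_vreach => //; exact: h).
all: route.
Qed.

Lemma unilateral_gadget m :
  temporally_unilaterally_connected m (gadget K n fA fB false) <->
  forall x y, x < n -> y < n -> meet x y.
Proof.
split=> [c x y xn yn|h u v].
  case: (c (ord_of K n fA fB false (VA x)) (ord_of K n fA fB false (VB y))) => [|r].
    exact: VA_reaches_VB.
  by have := @VB_reaches_VA false m x y erefl xn yn r.
suff c (v1 v2 : vert) : valid K n v1 -> valid K n v2 ->
    vreach false v1 v2 \/ vreach false v2 v1.
  rewrite -(ord_ofK u) -(ord_ofK v).
  by have [r|r] := c _ _ (valid_ord u) (valid_ord v); [left|right];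
    apply: vreach_reaches => //; apply: valid_ord.
move=> V1 V2.
case: v1 V1 => [||i|x|x|x i|x i] /= V1; case: v2 V2 => [||j|y|y|y j|y j] /= V2.
all: try by left; apply: meet_vreach => //; apply: h.
all: try by right; apply: meet_vreach => //; apply: h.
all: try by left; route.
all: by right; route.
Qed.

End GadgetReach.

(** * Scanning formulas *)

Definition bit (x i : nat) : bool := odd (x %/ 2 ^ i).

Lemma bits_of (a : nat -> bool) h :
  exists2 x, x < 2 ^ h & forall i, i < h -> bit x i = a i.
Proof.
elim: h a => [|h IH] a; first by exists 0.
have [x xh xa] := IH (fun i => a i.+1); exists (a 0 + x.*2).
  by rewrite expnS; case: (a 0) => /=; lia.
case=> [_|i ih]; rewrite /bit ?expn0 ?divn1 ?oddD ?odd_double ?addbF ?oddb //.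
rewrite expnS divnMA; have -> : (a 0 + x.*2) %/ 2 = x by case: (a 0) => /=; lia.
exact: xa.
Qed.

(* The state (r, b): r literals of the current clause are still to come, and b
   tells whether all of its previous literals are false. *)
Definition scan1 (sat : nat -> bool) (s : nat * bool) (z : nat) : nat * bool :=
  if s.1 == 0 then (z, true) else (s.1.-1, s.2 && ~~ sat z).

Definition scan (sat : nat -> bool) (w : seq nat) (j : nat) : nat * bool :=
  foldl (scan1 sat) (0, true) (take j w).

(* A false clause ends at position j of w. *)
Definition false_end (sat : nat -> bool) (w : seq nat) (j : nat) : bool :=
  let s := scan sat w j.+1 in (s.1 == 0) && s.2.

(** The counters depend on the word alone, and a literal is false for the disjunction iff it is
    false for both. So the two halves of the variables can be scanned separately. *)
Lemma false_end_or sat1 sat2 w j :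
  false_end sat1 w j && false_end sat2 w j =
  false_end (fun z => sat1 z || sat2 z) w j.
Proof.
rewrite /false_end /scan; move: (take j.+1 w) => {}w.
suff h r b1 b2 : let s1 := foldl (scan1 sat1) (r, b1) w in
    let s2 := foldl (scan1 sat2) (r, b2) w in
    let s := foldl (scan1 (fun z => sat1 z || sat2 z)) (r, b1 && b2) w in
    [/\ s.1 = s1.1, s.1 = s2.1 & s.2 = s1.2 && s2.2].
  have [/= -> e ->] := h 0 true true; rewrite -e; case: eqP; last by rewrite !andbF.
  by [].
elim: w r b1 b2 => //= z w IH [|r] b1 b2; rewrite /scan1 /=; first exact: (IH z true true).
have := IH r (b1 && ~~ sat1 z) (b2 && ~~ sat2 z).
by rewrite andbACA -negb_or.
Qed.

(** The search for a false clause end, from an arbitrary scan state to allow induction on the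
    word. *)
Fixpoint ends_false (sat : nat -> bool) (s : nat * bool) (w : seq nat) : bool :=
  if w is z :: w' then
    let s' := scan1 sat s z in (s'.1 == 0) && s'.2 || ends_false sat s' w'
  else false.

Lemma has_false_end sat w :
  has (false_end sat w) (iota 0 (size w)) = ends_false sat (0, true) w.
Proof.
rewrite /false_end /scan; elim: w (0, true) => //= z w IH s.
rewrite take0 /=; congr orb; rewrite -IH -[1]addn0 iotaDl has_map.
exact: eq_has.
Qed.

Lemma ends_false_literals sat c b w : c != [::] ->
  ends_false sat (size c, b) (c ++ w) =
  (b && all (fun z => ~~ sat z) c) || ends_false sat (0, b && all (fun z => ~~ sat z) c) w.
Proof.
have step z r b' w' : ends_false sat (r.+1, b') (z :: w') =
    (r == 0) && (b' && ~~ sat z) || ends_false sat (r, b' && ~~ sat z) w' by [].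
elim: c b => // z c IH b _; rewrite cat_cons step [all _ _]/=.
case: c IH => [|z' c] IH; first by rewrite /= !andbT.
by rewrite (IH _ isT) -!andbA.
Qed.

Lemma ends_false_clauses sat b (cs : seq (seq nat)) :
  ends_false sat (0, b) (flatten [seq size c :: c | c <- cs]) =
  has (all (fun z => ~~ sat z)) cs.
Proof.
elim: cs b => // c cs IH b; rewrite [has _ _]/= -(IH (all (fun z => ~~ sat z) c)).
(* An empty clause ends at its own length cell 0, where the state becomes [(0, true)]: it counts as
   false. *)
rewrite [flatten _]/=; case: c => // z c.
exact: (@ends_false_literals sat (z :: c) true).
Qed.

(** A literal code [z] has variable [z./2] and sign [odd z]. A literal of the other half counts as
    false. *)
Definition satA (h x z : nat) : bool := (z./2 < h) && (bit x z./2 == odd z).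

Definition satB (h y z : nat) : bool := (h <= z./2) && (bit y (z./2 - h) == odd z).

Definition word (k : nat) (phi : kcnf k) : seq nat :=
  flatten [seq size c :: [seq literal_code l | l <- c] | c <- clauses phi].

(** Rounded up, so that either half of the variables fits into [half phi] bits. *)
Definition half (k : nat) (phi : kcnf k) : nat := uphalf (nvars phi).

Definition falseA (k : nat) (phi : kcnf k) (x j : nat) : bool :=
  false_end (satA (half phi) x) (word phi) j.

Definition falseB (k : nat) (phi : kcnf k) (y j : nat) : bool :=
  false_end (satB (half phi) y) (word phi) j.

Lemma meet_false k (phi : kcnf k) x y :
  meet (size (word phi)) (falseA phi) (falseB phi) x y =
  ~~ all (has (fun l : literal _ =>
       (if l.1 < half phi then bit x l.1 else bit y (l.1 - half phi)) == l.2))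
     (clauses phi).
Proof.
rewrite /meet (eq_has (fun j => false_end_or _ _ _ _)) has_false_end.
have -> : word phi =
    flatten [seq size c :: c | c <- [seq [seq literal_code l | l <- c] | c <- clauses phi]].
  by rewrite -map_comp; congr flatten; apply: eq_map => c /=; rewrite size_map.
rewrite ends_false_clauses has_map -has_predC; apply: eq_has => c /=.
rewrite all_map -all_predC; apply: eq_all => -[v b] /=; congr negb.
rewrite /satA /satB /literal_code /=.
have -> : ((v : nat).*2 + b)./2 = v by case: b => /=; lia.
by rewrite oddD odd_double oddb /=; case: ltnP; rewrite ?orbF.
Qed.

Lemma meet_unsat k (phi : kcnf k) :
  (forall x y, x < 2 ^ half phi -> y < 2 ^ half phi ->
     meet (size (word phi)) (falseA phi) (falseB phi) x y) <-> ~ satisfiable phi.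
Proof.
split=> [h [a sat]|unsat x y _ _].
  (* Extended by [false], since for an odd number of variables the second half reads one bit too
     many. *)
  pose a' i := if insub i is Some v then a v else false.
  have a'E (v : 'I_(nvars phi)) : a' v = a v by rewrite /a' valK.
  have [x xh xa] := bits_of a' (half phi).
  have [y yh ya] := bits_of (fun i => a' (i + half phi)) (half phi).
  have := h x y xh yh; rewrite meet_false => /negP[]; move: sat; congr (is_true _).
  apply: eq_all => c; apply: eq_has => l; rewrite -a'E.
  case: ltnP => lh; first by rewrite xa.
  rewrite ya ?subnK //; move: lh (ltn_ord l.1); rewrite /half uphalfE.
  have aux i N : N.+1./2 <= i -> i < N -> i - N.+1./2 < N.+1./2 by lia.
  exact: aux.
rewrite meet_false; apply/negP => sat; apply: unsat.
by exists (fun v => if v < half phi then bit x v else bit y (v - half phi)).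
Qed.

(** * The program computing the gadget graph *)

Lemma runs_blk_eq V T ins s s' : T = size ins -> all straight ins ->
  fits_all V s ins -> foldl aexec s ins = s' -> runs V T (Blk ins) s s'.
Proof. by move=> -> st f <-; apply: runs_blk. Qed.

(* The output word is stored from address 0, the input word from address H. *)
Definition io_mem (H : nat) (out inp : seq nat) (i : nat) : nat :=
  if i < H then nth 0 out i else nth 0 inp (i - H).

Lemma io_mem_rcons H out inp v : size out < H ->
  [eta io_mem H out inp with size out |-> v] = io_mem H (rcons out v) inp :> (nat -> nat).
Proof.
move=> oH; apply/funext => i /=; rewrite /io_mem nth_rcons.
case: eqP => [->|_]; first by rewrite oH ltnn.
by case: ifP => // iH; case: ifP => // /negbT; rewrite -leqNgt => /(nth_default 0).
Qed.

Lemma io_mem_in H out inp i : io_mem H out inp (H + i) = nth 0 inp i.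
Proof. by rewrite /io_mem ltnNge leq_addr addKn. Qed.

(* Register 0 points to the end of the output, register 8 holds the current
   vertex and register 16 is 0; the edge leads to the vertex in register e.1. *)
Definition emit (e : nat * nat) : seq instr :=
  [:: Write 0 8; Add 0 0 1; Write 0 e.1; Add 0 0 1; Const 16 e.2; Write 0 16;
      Add 0 0 1; Const 16 0].

Definition emits (es : seq (nat * nat)) : cmd := Blk (flatten (map emit es)).

Lemma fits_all_cat V s i1 i2 :
  fits_all V s (i1 ++ i2) = fits_all V s i1 && fits_all V (foldl aexec s i1) i2.
Proof. by elim: i1 s => //= i i1 IH s; rewrite IH andbA. Qed.

(** [tl] holds the registers 1 to 19, so register [r.+1] is its entry [r]. The bound by [H] keeps
    the output off the input. *)
Lemma emit_step V H inp tl out r t :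
  size tl = 19 -> nth 0 tl 0 = 1 -> nth 0 tl 15 = 0 -> size out + 3 <= H <= V ->
  nth 0 tl 7 <= V -> nth 0 tl r <= V -> t <= V ->
  let s := (size out :: tl, io_mem H out inp) in
  let out' := out ++ [:: nth 0 tl 7; nth 0 tl r; t] in
  fits_all V s (emit (r.+1, t)) /\
  foldl aexec s (emit (r.+1, t)) = (size out' :: tl, io_mem H out' inp).
Proof.
do 19 (case: tl => [//|? tl]); case: tl => // _ /= -> -> /andP[oH HV] -> -> tV.
rewrite size_cat /= tV !addn1 addn3 -!cat_rcons cats0; split; first by lia.
by rewrite -!io_mem_rcons ?size_rcons //; lia.
Qed.

Lemma runs_emits V H inp es tl out :
  size tl = 19 -> nth 0 tl 0 = 1 -> nth 0 tl 15 = 0 ->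
  size out + 3 * size es <= H <= V -> nth 0 tl 7 <= V ->
  all (fun e => [&& 0 < e.1, nth 0 tl e.1.-1 <= V & e.2 <= V]) es ->
  runs V (8 * size es) (emits es) (size out :: tl, io_mem H out inp)
    (let out' := out ++ flatten [seq [:: nth 0 tl 7; nth 0 tl e.1.-1; e.2] | e <- es] in
     (size out' :: tl, io_mem H out' inp)).
Proof.
move=> stl tl1 tl0 oH uV esV.
set f := (fun e : nat * nat => [:: nth 0 tl 7; nth 0 tl e.1.-1; e.2]).
suff [fs ex] : 
    fits_all V (size out :: tl, io_mem H out inp) (flatten (map emit es)) /\
    foldl aexec (size out :: tl, io_mem H out inp) (flatten (map emit es)) =
    (size (out ++ flatten (map f es)) :: tl, io_mem H (out ++ flatten (map f es)) inp).
  apply: runs_blk_eq => //; last by elim: es {oH esV fs ex}.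
  by elim: es {oH esV fs ex} => //= e es ; lia.
elim: es out oH esV => [|[r t] es IH] out; first by rewrite /= cats0.
case: r => [|r] oH; rewrite [all _ _]/= // => /andP[/andP[rV tV] esV].
have oH3 : size out + 3 <= H <= V by move: oH => /=; lia.
have [fs ex] := emit_step inp stl tl1 tl0 oH3 uV rV tV.
have oH' : size (out ++ f (r.+1, t)) + 3 * size es <= H <= V.
  by move: oH; rewrite size_cat /=; lia.
have [fs' ex'] := IH _ oH' esV.
rewrite (_ : flatten (map emit _) = emit (r.+1, t) ++ flatten (map emit es)) //.
rewrite (_ : flatten (map f _) = f (r.+1, t) ++ flatten (map f es)) //.
by rewrite fits_all_cat foldl_cat ex fs (catA out) fs' ex'.
Qed.

(* Register 0 points to the end of the output word, and the input word is
   moved to H; n and j count the remaining rows and positions, x is the current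
   row, u the current vertex, a the number of VA x, p the address of the scanned
   cell, c the number of VC j, (r, bA) and (r, bB) the states of the two scans. *)
Definition regs (o K H h n x u a j p c r : nat) (bA bB : bool) (t1 t2 t3 : nat) : seq nat :=
  [:: o; 1; 0; K; H; h; n; x; u; a; j; p; c; r; bA : nat; bB : nat; t1; t2; t3; 2].

(** Expects [z], [z./2] and [i] in registers 16, 17 and 18. It halves [x] repeatedly, [i] times, and
    extracts the parities of the result and of [z] as [y - 2 * (y %/ 2)]. Their exclusive or, the
    sum of both truncated differences, is left in register 18: it is 1 iff the literal is false. *)
Definition test_bit : cmd :=
  Seq (Blk [:: Add 17 17 17; Defs.Sub 16 16 17; Add 17 7 2])
  (Seq (While 18 (Blk [:: Div 17 17 19; Defs.Sub 18 18 1]))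
  (Blk [:: Div 18 17 19; Add 18 18 18; Defs.Sub 17 17 18; Defs.Sub 18 17 16;
           Defs.Sub 17 16 17; Add 18 18 17])).

Ltac eq_state := rewrite /regs /=; congr pair; repeat (congr cons; try by lia).

Lemma runs_test_bit V m o K H h n x u a j p c r bA bB z i :
  x <= V -> z <= V -> i <= V -> 2 <= V ->
  exists t1 t2, runs V (4 * i + 10) test_bit
    (regs o K H h n x u a j p c r bA bB z z./2 i, m)
    (regs o K H h n x u a j p c r bA bB t1 t2 (bit x i != odd z), m).
Proof.
move=> xV zV iV V2.
exists (odd z), (odd z - bit x i).
have -> : 4 * i + 10 = 3 + ((i * 4).+1 + 6) by lia.
pose S k := (regs o K H h n x u a j p c r bA bB (odd z) (x %/ 2 ^ k) (i - k), m).
apply: (runs_seq (s' := S 0)).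
  apply: runs_blk_eq => //; first by rewrite /regs /=; lia.
  by eq_state.
apply: (runs_seq (s' := S i)).
  apply: (runs_while (T := 2)) => [k ki|]; last by rewrite /S /= subnn.
  have xk : x %/ 2 ^ k <= x by exact: leq_div.
  split; first by rewrite /S /=; lia.
  apply: runs_blk_eq => //; first by rewrite /S /regs /=; lia.
  by rewrite /S /regs /= -divnMA -expnSr subn1 -subnS.
have xi : x %/ 2 ^ i <= x by exact: leq_div.
rewrite /bit {}/S; move: (x %/ 2 ^ i) xi => y yx.
apply: runs_blk_eq => //; first by rewrite /regs /=; lia.
by eq_state.
Qed.

(** The truncated [h - z./2] is nonzero exactly for variables of the first half. The flag of the
    half owning the literal is multiplied by the result of the test. *)
Definition scan_literal : cmd :=
  Seq (Blk [:: Defs.Sub 13 13 1; Div 17 16 19; Defs.Sub 18 5 17])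
  (If 18
    (Seq (Blk [:: Add 18 17 2]) (Seq test_bit (Blk [:: Mul 14 14 18])))
    (Seq (Blk [:: Defs.Sub 18 17 5]) (Seq test_bit (Blk [:: Mul 15 15 18])))).

Definition scan_cell : cmd :=
  Seq (Blk [:: Read 16 11])
  (If 13 scan_literal (Blk [:: Add 13 16 2; Const 14 1; Const 15 1])).

Lemma runs_scan_cell V Z m o K H h n x u a j p c r bA bB t1 t2 t3 :
  x <= V -> h <= V -> p <= V -> m p <= Z <= V -> r <= V -> 2 <= V ->
  let sA := scan1 (satA h x) (r, bA) (m p) in
  let sB := scan1 (satB h x) (r, bB) (m p) in
  exists t1' t2' t3', runs V (4 * Z + 20) scan_cell
    (regs o K H h n x u a j p c r bA bB t1 t2 t3, m)
    (regs o K H h n x u a j p c sA.1 sA.2 sB.2 t1' t2' t3', m).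
Proof.
move=> xV hV pV /andP[]; set z := m p => zZ ZV rV V2 sA sB.
pose S0 := (regs o K H h n x u a j p c r bA bB z t2 t3, m).
suff [t1' [t2' [t3' run]]] : exists t1' t2' t3', runs V (4 * Z + 19)
    (If 13 scan_literal (Blk [:: Add 13 16 2; Const 14 1; Const 15 1])) S0
    (regs o K H h n x u a j p c sA.1 sA.2 sB.2 t1' t2' t3', m).
  exists t1', t2', t3'; have -> : 4 * Z + 20 = 1 + (4 * Z + 19) by lia.
  apply: runs_seq run; apply: runs_blk_eq => //.
  by rewrite /regs /= -/z; lia.
case: r rV @sA @sB @S0 => [|r] rV sA sB S0.
  exists z, t2, t3; apply: (@runs_weaken _ 5); first by lia.
  apply: runs_if => //; rewrite [nth _ _ _ == _]/=.
  apply: runs_blk_eq => //; first by rewrite /regs /=; lia.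
  by rewrite /regs /= addn0.
have zz : z <= z by [].
case: (ltnP z./2 h) => zh.
  have [t1' [t2' run]] := @runs_test_bit V m o K H h n x u a j p c r bA bB z z./2
    xV (leq_trans zZ ZV) (ltac:(lia)) V2.
  exists t1', t2', (bit x z./2 != odd z).
  apply: (@runs_weaken _ (3 + (1 + (4 * z./2 + 10 + 1)).+2).+2); first by lia.
  apply: runs_if => //; rewrite [nth _ _ _ == _]/=.
  apply: (runs_seq (s' := (regs o K H h n x u a j p c r bA bB z z./2 (h - z./2), m))).
    apply: runs_blk_eq => //; first by rewrite /regs /=; lia.
    by rewrite /regs /= subn1 divn2.
  apply: runs_if => //=; first by lia.
  rewrite subn_eq0 leqNgt zh /=.
  apply: runs_seq; first apply: runs_blk_eq => //; first by rewrite /regs /=; lia.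
  apply: runs_seq; first by rewrite /regs /= addn0; exact: run.
  apply: runs_blk_eq => //; first by rewrite /regs /=; lia.
  rewrite /sA /sB /scan1 /= /satA /satB zh leqNgt zh /=.
  by eq_state.
have [t1' [t2' run]] := @runs_test_bit V m o K H h n x u a j p c r bA bB z (z./2 - h)
  xV (leq_trans zZ ZV) (ltac:(lia)) V2.
exists t1', t2', (bit x (z./2 - h) != odd z).
apply: (@runs_weaken _ (3 + (1 + (4 * (z./2 - h) + 10 + 1)).+2).+2); first by lia.
apply: runs_if => //; rewrite [nth _ _ _ == _]/=.
apply: (runs_seq (s' := (regs o K H h n x u a j p c r bA bB z z./2 (h - z./2), m))).
  apply: runs_blk_eq => //; first by rewrite /regs /=; lia.
  by rewrite /regs /= subn1 divn2.
apply: runs_if => //=; first by lia.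
rewrite subn_eq0 zh /=.
apply: runs_seq; first apply: runs_blk_eq => //; first by rewrite /regs /=; lia.
apply: runs_seq; first by rewrite /regs /=; exact: run.
apply: runs_blk_eq => //; first by rewrite /regs /=; lia.
rewrite /sA /sB /scan1 /= /satA /satB zh ltnNge zh /=.
by eq_state.
Qed.

(** The truncated [1 - r] times the flag indicates a false clause end; times the number of [VA x] or
    [VB x] it gives the endpoint of the core edge, or 0, which is [Hub]. Registers 2 and 1 serve as
    the numbers of the hubs. Emitted times exceed those of [down] by 1, as the encoding requires. *)
Definition position_body : cmd :=
  Seq scan_cell
  (Seq (Blk [:: Defs.Sub 17 1 13; Mul 17 17 14; Mul 18 17 9; Const 16 0])
  (Seq (emits [:: (2, 2); (2, 3); (18, 7); (12, 8); (1, 13)])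
  (Seq (Blk [:: Add 8 8 1; Defs.Sub 17 1 13; Mul 17 17 15; Add 18 9 1; Mul 18 18 17])
  (Seq (emits [:: (2, 2); (2, 3); (12, 9); (18, 10); (1, 13)])
  (Blk [:: Add 8 8 1; Defs.Sub 10 10 1; Add 11 11 1; Add 12 12 1; Const 17 0; Const 18 0]))))).

Definition row_body : cmd :=
  Seq (Blk [:: Add 9 8 2])
  (Seq (emits [:: (1, 11); (1, 12)])
  (Seq (Blk [:: Add 8 8 1])
  (Seq (emits [:: (2, 4); (2, 5)])
  (Seq (Blk [:: Add 8 8 1; Add 10 3 2; Add 11 4 1; Const 12 2; Const 14 1; Const 15 1])
  (Seq (While 10 position_body)
  (Blk [:: Defs.Sub 6 6 1; Add 7 7 1; Const 9 0; Const 11 0; Const 12 0; Const 13 0;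
           Const 14 0; Const 15 0])))))).

(** The input is moved up to [H] to make room for the output. In the end its copy and the auxiliary
    registers are cleared, so that the final state looks like the initial state on the output
    word. *)
Definition build_graph (conn : bool) : cmd :=
  (* K, h and n = 2 ^ h *)
  Seq (Blk [:: Const 1 1; Const 19 2; Defs.Sub 3 0 1; Read 16 2; Add 16 16 1;
               Div 5 16 19; Const 6 1; Add 18 5 2; Const 16 0])
  (Seq (While 18 (Blk [:: Add 6 6 6; Defs.Sub 18 18 1]))
  (* the number of vertices in register 17, and H *)
  (Seq (Blk [:: Mul 17 19 3; Add 17 17 19; Mul 17 17 6; Add 17 17 3; Add 17 17 19;
                Const 16 16; Mul 4 17 16; Add 4 4 16; Add 10 3 1; Const 16 0])
  (Seq (While 10 (Blk [:: Defs.Sub 10 10 1; Read 16 10; Add 18 4 10; Write 18 16;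
                          Write 10 2; Const 16 0; Const 18 0]))
  (Seq (Blk [:: Const 0 0; Write 0 17; Add 0 0 1; Const 16 14; Write 0 16; Add 0 0 1;
                Const 16 0; Const 17 0; Const 8 1])
  (Seq (emits ((2, 1) :: if conn then [:: (2, 6); (2, 14)] else [::]))
  (Seq (Blk [:: Const 8 2; Add 10 3 2])
  (Seq (While 10 (Seq (emits [:: (2, 2); (2, 3); (1, 13)])
                      (Blk [:: Add 8 8 1; Defs.Sub 10 10 1])))
  (Seq (While 6 row_body)
  (Seq (Blk [:: Add 10 3 1])
  (Seq (While 10 (Blk [:: Defs.Sub 10 10 1; Add 18 4 10; Write 18 2; Const 18 0]))
  (Blk [seq Const d 0 | d <- iota 1 19]))))))))))).

(** * Correctness and running time of the program *)

Section BuildGraph.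

Variables (conn : bool) (N K h n Z nv H V : nat) (w : seq nat).

Let fA x j := false_end (satA h x) w j.
Let fB y j := false_end (satB h y) w j.
Let inp := N :: w.

(** The output once the vertices in [s] have been treated. Edges are listed at their larger
    endpoint, so a new vertex only appends to it. *)
Definition code (s : seq vert) : seq nat := nv :: 14 ::
  flatten [seq [:: z.1.1; z.1.2; z.2.+1]
          | z <- flatten (map (triples_of K fA fB conn) s)].

Lemma code_rcons s v : code (rcons s v) =
  code s ++ flatten [seq [:: num K v; num K e.1; e.2.+1] | e <- down fA fB conn v].
Proof.
rewrite /code map_rcons flatten_rcons map_cat flatten_cat; congr (_ :: _ :: _ ++ _).
by rewrite /triples_of -map_comp.
Qed.

(** At most five edges per vertex, three cells each, and two leading cells; so the output stays
    below [H = 16 * nv + 16]. *)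
Lemma size_code s : size (code s) <= 15 * size s + 2.
Proof.
elim/last_ind: s => // s v IH; rewrite code_rcons size_cat size_rcons.
suff : size (flatten [seq [:: num K v; num K e.1; e.2.+1] | e <- down fA fB conn v]) <= 15.
  lia.
by case: v {IH} => //=; case: conn.
Qed.

Hypotheses (wK : size w = K) (hN : h = uphalf N) (nE : n = 2 ^ h)
  (nvE : nv = K.+2 + n * K.+1.*2) (HE : H = 16 * nv + 16) (VE : V = 2 * H)
  (wZ : all (leq^~ Z) w) (ZV : Z <= V) (NV : N < V).

(** At most five edges of eight instructions each: 40 units. *)
Lemma runs_vertex s v es tl :
  size tl = 19 -> nth 0 tl 0 = 1 -> nth 0 tl 15 = 0 ->
  valid K n v -> size s = num K v -> nth 0 tl 7 = num K v ->
  all (fun e => 0 < e.1) es ->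
  [seq (nth 0 tl e.1.-1, e.2) | e <- es] =
    [seq (num K e.1, e.2.+1) | e <- down fA fB conn v] ->
  runs V 40 (emits es) (size (code s) :: tl, io_mem H (code s) inp)
    (size (code (rcons s v)) :: tl, io_mem H (code (rcons s v)) inp).
Proof.
move=> stl tl1 tl0 vv sv tlv es0 esE.
have vnv : num K v < nv by have := num_lt vv; rewrite /nverts' nvE; lia.
have se : size es <= 5.
  rewrite -(size_map (fun e : nat * nat => (nth 0 tl e.1.-1, e.2)) es) esE size_map.
  by case: v {vv sv tlv esE vnv} => //=; case: conn.
have -> : code (rcons s v) =
    code s ++ flatten [seq [:: nth 0 tl 7; nth 0 tl e.1.-1; e.2] | e <- es].
  rewrite code_rcons; congr cat; congr flatten.
  have := congr1 (map (fun q : nat * nat => [:: num K v; q.1; q.2])) esE.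
  by rewrite -!map_comp tlv => <-.
have ss := size_code s; rewrite sv in ss.
apply: (@runs_weaken _ (8 * size es)); first by lia.
apply: runs_emits => //; first by lia.
  by rewrite tlv; lia.
apply/allP => e ein; rewrite (allP es0 _ ein) /=.
have : (nth 0 tl e.1.-1, e.2) \in [seq (num K e.1, e.2.+1) | e <- down fA fB conn v].
  by rewrite -esE; apply: map_f.
case/mapP => -[b t] bv [-> ->] /=.
by have [/= bn bt] := num_down vv bv; lia.
Qed.

Lemma code_Hub : code [:: Hub] = [:: nv; 14]. Proof. by []. Qed.

Local Opaque code.

Let start : seq vert := [:: Hub; LateHub].
Let pairs x j := flatten [seq [:: VP x j; VQ x j] | j <- iota 0 j].
Let row_start i := start ++ map VC (iota 0 K) ++ flatten (map (row_verts K) (iota 0 i)).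
Let pos_start i j := rcons (rcons (row_start i) (VA i)) (VB i) ++ pairs i j.

Lemma size_row_start i : size (row_start i) = base K i.
Proof.
rewrite !size_cat size_map size_iota -(size_map (num K) (flatten _)) num_rows size_iota.
by rewrite /base /=; lia.
Qed.

Lemma size_pos_start i j : size (pos_start i j) = base K i + j.+1.*2.
Proof.
rewrite size_cat !size_rcons size_row_start -(size_map (num K) (flatten _)) num_pairs size_iota.
by lia.
Qed.

Lemma base_le i : i < n -> base K i + K.+1.*2 <= nv.
Proof.
move=> i_n; have : i.+1 * K.+1.*2 <= n * K.+1.*2 by rewrite leq_mul2r i_n orbT.
rewrite nvE /base; lia.
Qed.

Lemma scan_snoc sat j : j < K -> scan sat w j.+1 = scan1 sat (scan sat w j) (nth 0 w j).
Proof.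
by move=> jK; rewrite /scan (take_nth 0) ?wK // foldl_rcons.
Qed.

(** Hence one register can hold the counter of both scans. *)
Lemma scan_rem sat sat' j : (scan sat w j).1 = (scan sat' w j).1.
Proof.
rewrite /scan; elim/last_ind: (take j w) => // s z IH.
by rewrite !foldl_rcons /scan1 IH; case: ifP.
Qed.

Lemma scan_le sat j : (scan sat w j).1 <= Z.
Proof.
rewrite /scan; have : all (leq^~ Z) (take j w) by apply/allP => z /mem_take/(allP wZ).
elim/last_ind: (take j w) => // s z IH.
rewrite all_rcons foldl_rcons => /andP[zZ /IH] {}IH; rewrite /scan1; case: ifP => //= _.
exact: leq_trans (leq_pred _) IH.
Qed.

Lemma runs_position x j : x < n -> j < K ->
  let S j := (regs (size (code (pos_start x j))) K H h (n - x) x (num K (VP x j))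
      (base K x) (K - j) (H + j.+1) j.+2 (scan (satA h x) w j).1
      (scan (satA h x) w j).2 (scan (satB h x) w j).2 0 0 0,
    io_mem H (code (pos_start x j)) inp) in
  runs V (4 * Z + 120) position_body (S j) (S j.+1).
Proof.
move=> xn jK S.
have bnv := base_le xn.
have hn : h < n by rewrite nE ltn_expl.
have ze : io_mem H (code (pos_start x j)) inp (H + j.+1) = nth 0 w j by rewrite io_mem_in.
have zZ : nth 0 w j <= Z by apply: (allP wZ); rewrite mem_nth ?wK.
have rZ := scan_le (satA h x) j.
have nn : n <= nv by rewrite nvE; nia.
have [t1 [t2 [t3 run]]] := @runs_scan_cell V Z (io_mem H (code (pos_start x j)) inp)
  (size (code (pos_start x j))) K H h (n - x) x (num K (VP x j))
  (base K x) (K - j) (H + j.+1) j.+2 (scan (satA h x) w j).1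
  (scan (satA h x) w j).2 (scan (satB h x) w j).2 0 0 0
  (ltac:(lia)) (ltac:(lia)) (ltac:(lia)) (ltac:(rewrite ze; lia)) (ltac:(lia)) (ltac:(lia)).
move: run; rewrite ze.
rewrite (_ : (_, (scan (satB h x) w j).2) = scan (satB h x) w j); last first.
  by rewrite (scan_rem _ (satB h x)); case: (scan _ _ _).
rewrite -surjective_pairing -!scan_snoc // => run.
have fAE : (((scan (satA h x) w j.+1).1 == 0) && (scan (satA h x) w j.+1).2) = fA x j by [].
have fBE : (((scan (satA h x) w j.+1).1 == 0) && (scan (satB h x) w j.+1).2) = fB x j.
  by rewrite (scan_rem _ (satB h x)).
move: fAE fBE run; rewrite {}/S; move: (scan_le (satA h x) j.+1).
move: (scan (satA h x) w j.+1) (scan (satB h x) w j.+1).2 => [r bA] bB /= rZ' fAE fBE run.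
have -> : 4 * Z + 120 = (4 * Z + 20) + (4 + (40 + (5 + (40 + 11)))) by lia.
apply: runs_seq run _.
apply: (runs_seq (s' := (regs (size (code (pos_start x j))) K H h (n - x) x (num K (VP x j))
      (base K x) (K - j) (H + j.+1) j.+2 r bA bB 0 (fA x j)
      (num K (if fA x j then VA x else Hub)),
    io_mem H (code (pos_start x j)) inp))).
  have := size_code (pos_start x j); rewrite size_pos_start.
  move: (size (code _)) (io_mem _ _ _) => o m oV.
  apply: runs_blk_eq => //; first by rewrite /regs /=; case: (bA); lia.
  by rewrite /regs /= -fAE; case: r bA {rZ' fAE fBE} => [|r] [] //=;
    congr pair; repeat (congr cons; try by lia).
have sp := size_pos_start x j.
apply: runs_seq; first apply: (@runs_vertex _ (VP x j)) => //=; first by rewrite xn.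
pose s1 := rcons (pos_start x j) (VP x j).
have s1s : size s1 = base K x + j.+1.*2.+1 by rewrite size_rcons sp; lia.
apply: (runs_seq (s' := (regs (size (code s1)) K H h (n - x) x (num K (VQ x j))
      (base K x) (K - j) (H + j.+1) j.+2 r bA bB 0 (fB x j)
      (num K (if fB x j then VB x else Hub)),
    io_mem H (code s1) inp))).
  have := size_code s1; rewrite s1s.
  move: (size (code _)) (io_mem _ _ _) => o m oV.
  apply: runs_blk_eq => //; first by rewrite /regs /=; case: (bB); lia.
  by rewrite /regs /= -fBE; case: r bB {rZ' fAE fBE} => [|r] [] //=;
    congr pair; repeat (congr cons; try by lia).
apply: runs_seq; first apply: (@runs_vertex s1 (VQ x j)) => //=; first by rewrite xn.
have -> : pos_start x j.+1 = rcons s1 (VQ x j).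
  rewrite /pos_start /pairs -(addn1 j) iotaD map_cat flatten_cat /s1 catA.
  by rewrite -(cats1 _ (VQ x j)) -(cats1 _ (VP x j)) -[RHS]catA.
apply: (@runs_weaken _ 6) => //; apply: runs_blk_eq => //.
  by rewrite /regs /=; lia.
by eq_state.
Qed.

Lemma row_start_snoc i : row_start i.+1 = pos_start i K.
Proof.
rewrite /row_start /pos_start -(addn1 i) iotaD map_cat flatten_cat !catA /= cats0.
by rewrite -!cats1 -!catA.
Qed.

Lemma runs_row i : i < n ->
  let S i := (regs (size (code (row_start i))) K H h (n - i) i (base K i)
      0 0 0 0 0 false false 0 0 0, io_mem H (code (row_start i)) inp) in
  runs V (K * (4 * Z + 122) + 97) row_body (S i) (S i.+1).
Proof.
move=> i_n S.
have bnv := base_le i_n.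
have hn : h < n by rewrite nE ltn_expl.
have nn : n <= nv by rewrite nvE; nia.
have sr := size_row_start i.
have -> : K * (4 * Z + 122) + 97 =
  1 + (40 + (1 + (40 + (6 + ((K * (4 * Z + 120).+2).+1 + 8))))) by lia.
apply: (runs_seq (s' := (regs (size (code (row_start i))) K H h (n - i) i (base K i)
      (base K i) 0 0 0 0 false false 0 0 0, io_mem H (code (row_start i)) inp))).
  apply: runs_blk_eq => //; first by rewrite /regs /=; lia.
  by rewrite /regs /= addn0.
apply: runs_seq; first exact: (@runs_vertex _ (VA i)).
pose s1 := rcons (row_start i) (VA i).
have s1s : size s1 = num K (VB i) by rewrite size_rcons sr.
apply: (runs_seq (s' := (regs (size (code s1)) K H h (n - i) i (num K (VB i))
      (base K i) 0 0 0 0 false false 0 0 0, io_mem H (code s1) inp))).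
  apply: runs_blk_eq => //; first by rewrite /regs /=; lia.
  by rewrite /regs /= addn1.
apply: runs_seq; first exact: (@runs_vertex s1 (VB i)).
pose P j := (regs (size (code (pos_start i j))) K H h (n - i) i (num K (VP i j))
      (base K i) (K - j) (H + j.+1) j.+2 (scan (satA h i) w j).1
      (scan (satA h i) w j).2 (scan (satB h i) w j).2 0 0 0,
    io_mem H (code (pos_start i j)) inp).
apply: (runs_seq (s' := P 0)).
  apply: runs_blk_eq => //; first by rewrite /regs /=; lia.
  rewrite /P /pos_start /pairs /scan take0 cats0 -/s1 /regs /=.
  by eq_state.
apply: (runs_seq (s' := P K)).
  apply: runs_while => [j jK|]; last by rewrite /= subnn.
  by split; [rewrite /=; lia | exact: runs_position].
have rZ := scan_le (satA h i) K.
rewrite /P /S row_start_snoc; apply: runs_blk_eq => //; first by rewrite /regs /=; lia.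
by rewrite /regs /=; congr pair; repeat (congr cons; try by rewrite /base; lia).
Qed.

(** The memory when the last [i] of the [K.+1] input cells have been moved up by [H]. *)
Definition moved (i a : nat) : nat :=
  if a < H then (if a < K.+1 - i then nth 0 inp a else 0)
  else if K.+1 - i <= a - H then nth 0 inp (a - H) else 0.

Lemma moved_step i : i < K.+1 -> let q := K.+1 - i - 1 in
  [eta [eta moved i with H + q |-> nth 0 inp q] with q |-> 0] = moved i.+1 :> (nat -> nat).
Proof.
move=> iK q; have KH : K.+1 < H by rewrite HE nvE; lia.
apply/funext => a; rewrite /moved /=; case: eqP => [->|/eqP aq].
  by rewrite ifT ?[RHS]ifF //; rewrite /q; lia.
case: eqP => [->|/eqP aHq].
  by rewrite addKn ifF ?ifT //; rewrite /q; lia.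
case: ltnP => aH; first by congr (if _ then _ else _); rewrite /q in aq; lia.
by congr (if _ then _ else _); move: aHq; rewrite /q; lia.
Qed.

Lemma inp_le a : nth 0 inp a <= V.
Proof.
have [aK|] := ltnP a (size inp); last by move=> /(nth_default 0) ->.
have : all (leq^~ V) inp.
  rewrite /inp /= ltnW //; apply/allP => z /(allP wZ) zZ; exact: leq_trans ZV.
by move=> /allP; apply; rewrite mem_nth.
Qed.

Lemma runs_move t2 : let S i := (regs K.+1 K H h n 0 0 0 (K.+1 - i) 0 0 0 false false 0 t2 0,
    moved i) in
  runs V (K.+1 * 9).+1
    (While 10 (Blk [:: Defs.Sub 10 10 1; Read 16 10; Add 18 4 10; Write 18 16;
                          Write 10 2; Const 16 0; Const 18 0])) (S 0) (S K.+1).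
Proof.
move=> S; have KH : K.+1 < H by rewrite HE nvE; lia.
apply: (runs_while (T := 7)) => [i iK|]; last by rewrite /= subnn.
split; first by rewrite /=; lia.
set q := K.+1 - i - 1.
have mq : moved i q = nth 0 inp q by rewrite /moved !ifT // /q; lia.
have mqV := inp_le q.
apply: runs_blk_eq => //; first by rewrite /S /regs /= -/q mq; lia.
rewrite /S -moved_step // -/q /regs /= -/q mq.
by congr pair; repeat (congr cons; try by rewrite /q; lia).
Qed.

Lemma runs_VCs : let S j :=
    let s := start ++ map VC (iota 0 j) in
    (regs (size (code s)) K H h n 0 j.+2 0 (K - j) 0 0 0 false false 0 0 0,
     io_mem H (code s) inp) in
  runs V (K * 44).+1
    (While 10 (Seq (emits [:: (2, 2); (2, 3); (1, 13)])
                      (Blk [:: Add 8 8 1; Defs.Sub 10 10 1]))) (S 0) (S K).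
Proof.
move=> S; have KH : 3 * K < H by rewrite HE nvE; lia.
apply: (runs_while (T := 42)) => [j jK|]; last by rewrite /= subnn.
split; first by rewrite /=; lia.
have ss : size (start ++ map VC (iota 0 j)) = j.+2.
  by rewrite size_cat size_map size_iota.
apply: (runs_seq (T1 := 40)); first exact: (@runs_vertex _ (VC j)).
have sE : start ++ map VC (iota 0 j.+1) = rcons (start ++ map VC (iota 0 j)) (VC j).
  by rewrite -(addn1 j) iotaD map_cat catA cats1.
rewrite {}/S sE.
apply: runs_blk_eq => //; first by rewrite /regs /=; lia.
by eq_state.
Qed.

Lemma runs_clear o out x u : let S i :=
    (regs o K H h 0 x u 0 (K.+1 - i) 0 0 0 false false 0 0 0,
     io_mem H out (take (K.+1 - i) inp)) in
  runs V (K.+1 * 6).+1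
    (While 10 (Blk [:: Defs.Sub 10 10 1; Add 18 4 10; Write 18 2; Const 18 0])) (S 0) (S K.+1).
Proof.
move=> S; have KH : K.+1 < H by rewrite HE nvE; lia.
apply: (runs_while (T := 4)) => [i iK|]; last by rewrite /= subnn.
split; first by rewrite /=; lia.
apply: runs_blk_eq => //; first by rewrite /S /regs /=; lia.
rewrite /S /regs /=; congr pair; first by repeat (congr cons; try by lia).
apply/funext => a; rewrite /io_mem /=.
have ni m b : nth 0 (take m inp) b = if b < m then nth 0 inp b else 0.
  case: ltnP => bm; first by rewrite nth_take.
  by rewrite nth_default // size_take_min geq_min bm.
case: eqP => [->|/eqP aq].
  by rewrite ifF ?ni ?ifF //; lia.
case: ifP => // aH; rewrite !ni; congr (if _ then _ else _); lia.
Qed.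

(** The rows dominate: [n] times [K] positions, each taking O(Z) units because a bit is found by
    repeated halving. *)
Lemma runs_build :
  runs V (n * (K * (4 * Z + 122) + 99) + 4 * h + 59 * K + 110)
    (build_graph conn) (K.+1 :: nseq 19 0, nth 0 inp)
    (let out := code (verts K n) in (size out :: nseq 19 0, nth 0 out)).
Proof.
have KH : K.+1 < H by rewrite HE nvE; lia.
have hn : h < n by rewrite nE ltn_expl.
have nn : n <= nv by rewrite nvE; nia.
pose S1 i := (regs K.+1 K 0 h (2 ^ i) 0 0 0 0 0 0 0 false false 0 0 (h - i), nth 0 inp).
pose S5 := (regs 2 K H h n 0 1 0 0 0 0 0 false false 0 0 0, io_mem H (code [:: Hub]) inp).
pose S6 u j := (regs (size (code start)) K H h n 0 u 0 j 0 0 0 false false 0 0 0,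
  io_mem H (code start) inp).
pose S9 j i := (regs (size (code (row_start i))) K H h (n - i) i (base K i)
      0 j 0 0 0 false false 0 0 0, io_mem H (code (row_start i)) inp).
(* One summand for each of the consecutive pieces of [build_graph]. *)
rewrite (_ : n * _ + _ + _ + _ = 9 + ((h * 4).+1 + (10 + ((K.+1 * 9).+1 + (9 + (40 + (2 +
  ((K * 44).+1 + ((n * (K * (4 * Z + 122) + 97).+2).+1 +
  (1 + ((K.+1 * 6).+1 + 19))))))))))); last by lia.
apply: (runs_seq (s' := S1 0)).
  have NV' : N <= V by exact: ltnW.
  apply: runs_blk_eq => //; first by rewrite /=; lia.
  rewrite /S1 /regs /= hN uphalfE -divn2 addn1 subn0.
  by eq_state.
apply: (runs_seq (s' := S1 h)).
  apply: (runs_while (T := 2)) => [i ih|]; last by rewrite /= subnn.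
  have : 2 ^ i <= n by rewrite nE leq_exp2l // ltnW.
  split; first by rewrite /=; lia.
  apply: runs_blk_eq => //; first by rewrite /S1 /regs /=; lia.
  rewrite /S1 /regs /= addnn -mul2n -expnS.
  by eq_state.
apply: (runs_seq (s' := (regs K.+1 K H h n 0 0 0 (K.+1 - 0) 0 0 0 false false 0 nv 0, moved 0))).
  rewrite /S1 -nE subnn; apply: runs_blk_eq => //; first by rewrite /regs /=; lia.
  rewrite /regs /=; congr pair; first by repeat (congr cons; try by lia).
  apply/funext => a; rewrite /moved subn0; case: ltnP => aH.
    by case: ltnP => // aK; rewrite nth_default // /inp /= wK.
  by rewrite nth_default ?if_same //= ?wK; [case: ltnP => // ?; rewrite nth_default //= wK | lia].
apply: (runs_seq (runs_move nv)).
apply: (runs_seq (s' := S5)).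
  have -> : moved K.+1 = io_mem H [::] inp.
    by apply/funext => a; rewrite /moved subnn /io_mem /= nth_nil.
  have outE : [eta [eta io_mem H [::] inp with 0 |-> nv] with 1 |-> 14] =
      io_mem H [:: nv; 14] inp :> (nat -> nat).
    rewrite (io_mem_rcons (out := [::])); last by rewrite /=; lia.
    by rewrite (io_mem_rcons (out := [:: nv])) //=; lia.
  rewrite subnn /S5 code_Hub -outE.
  by apply: runs_blk_eq => //; rewrite /regs /=; lia.
apply: (runs_seq (s' := S6 1 0)).
  apply: (@runs_vertex [:: Hub] LateHub) => //=; first by case: conn.
  by case: conn.
apply: (runs_seq (s' := S6 2 K)).
  apply: runs_blk_eq => //; first by rewrite /regs /=; lia.
  by rewrite /S6 /regs /= addn0.
apply: (runs_seq (s' := S9 0 0)).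
  have VCs := runs_VCs; cbv zeta beta in VCs.
  rewrite [map VC (iota 0 0)]/= cats0 subn0 subnn in VCs.
  by rewrite /S9 /row_start [flatten _]/= cats0 subn0 /base mul0n addn0.
apply: (runs_seq (s' := S9 0 n)).
  apply: runs_while => [i i_n|]; last by rewrite /= subnn.
  by split; [rewrite /=; lia | exact: runs_row].
apply: (runs_seq (s' := S9 K.+1 n)).
  apply: runs_blk_eq => //; first by rewrite /S9 subnn /regs /=; lia.
  by rewrite /S9 /regs /= addn1.
have rowsE : row_start n = verts K n by [].
have := size_code (verts K n); rewrite size_verts /nverts' => sV.
have clear_run := @runs_clear (size (code (verts K n))) (code (verts K n)) n (base K n).
cbv zeta beta in clear_run.
rewrite subn0 subnn take0 take_oversize in clear_run; last by rewrite /= wK.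
rewrite /S9 subnn rowsE; apply: (runs_seq clear_run).
apply: runs_blk_eq => //; rewrite /= ; congr pair; apply/funext => a.
rewrite /io_mem; case: ltnP => // aH; rewrite nth_nil nth_default //.
by apply: leq_trans aH; rewrite HE nvE; lia.
Qed.

End BuildGraph.

(** * The reduction *)

(* All halting jumps of the shifted program lead to its end. *)
Definition shift_instr (l e : nat) (i : instr) : instr :=
  match i with
  | Jump t => Jump (l + minn t e)
  | Jz a t => Jz a (l + minn t e)
  | _ => i
  end.

Definition shift_state (l e : nat) (s : state) : state :=
  State (l + minn (pc s) e) (reg s) (Defs.mem s).

Lemma msteps_shift P1 P P2 s c s' : exec P s c s' ->
  msteps (P1 ++ map (shift_instr (size P1) (size P)) P ++ P2)
    (shift_state (size P1) (size P) s) c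
    (State (size P1 + size P) (reg s') (Defs.mem s')).
Proof.
elim=> [{}s sN|{}s i {}c {}s' si _ IH].
  have sP : size P <= pc s by rewrite -onthNE sN.
  by rewrite /shift_state (minn_idPr sP); apply: msteps_refl.
have sP : pc s < size P by rewrite -onthTE si.
have -> : cost i s = cost (shift_instr (size P1) (size P) i) (shift_state (size P1) (size P) s).
  by case: i {si IH}.
apply: msteps_step.
  rewrite /= (minn_idPl (ltnW sP)) onth_cat_r onth_cat size_map sP.
  by rewrite onth_map si.
move: IH; congr (msteps _ _ _ _).
have pcE : size P1 + minn (pc s).+1 (size P) = (size P1 + minn (pc s) (size P)).+1.
  by rewrite (minn_idPl sP) (minn_idPl (ltnW sP)) addnS.
case: i {si} => [d k|d a b|d a b|d a b|d a b|d a|a b|t|a t] //=;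
  rewrite /shift_state /set_reg /= ?pcE //.
by case: ifP => // _; rewrite pcE.
Qed.

(** Connectedness of the gadget graph means unsatisfiability, so the answer has to be flipped. *)
Definition negate_at (l : nat) : program :=
  [:: Jz 0 (l + 3); Const 0 0; Jump (l + 4); Const 0 1].

Lemma exec_negate P s : exists2 c, c <= bits (reg s 0) + 2 &
  exists2 s', exec (P ++ negate_at (size P)) (State (size P) (reg s) (Defs.mem s)) c s' &
    (accepting s' <-> ~ accepting s).
Proof.
set W := _ ++ _.
have W_ i : onth W (size P + i) = onth (negate_at (size P)) i by exact: onth_cat_r.
have W0 : onth W (size P) = Some (Jz 0 (size P + 3)) by rewrite -[size P]addn0 W_ addn0.
pose s0 := State (size P) (reg s) (Defs.mem s).
have [r0|r0] := eqVneq (reg s 0) 0.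
  pose s1 := State (size P + 3) (reg s) (Defs.mem s).
  exists (cost (Jz 0 (size P + 3)) s0 + (cost (Const 0 1) s1 + 0)).
    exact: (leq_add (leqnn _) (isT : bits 1 + 0 <= 2)).
  exists (step (Const 0 1) s1); last by rewrite /accepting /= r0.
  apply: (@exec_step _ s0); first exact: W0.
  rewrite (_ : step _ s0 = s1); last by rewrite /= r0.
  apply: exec_step; first by rewrite W_.
  by apply: exec_halt; rewrite [pc _]/= -addnS W_.
pose s1 := State (size P + 1) (reg s) (Defs.mem s).
exists (cost (Jz 0 (size P + 3)) s0 + (cost (Const 0 0) s1 + (1 + 0))).
  exact: (leq_add (leqnn _) (isT : bits 0 + (1 + 0) <= 2)).
exists (State (size P + 4) [eta reg s with 0 |-> 0] (Defs.mem s)).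
  apply: (@exec_step _ s0); first exact: W0.
  rewrite (_ : step _ s0 = s1); last by rewrite /= (negPf r0) -addn1.
  apply: exec_step; first by rewrite W_.
  apply: (@exec_step _ _ (Jump (size P + 4))); first by rewrite [pc _]/= -addnS W_.
  by apply: exec_halt; rewrite W_.
by split=> [//|[]]; exact: r0.
Qed.

Definition reduction (conn : bool) (P : program) : program :=
  let P1 := comp 0 (build_graph conn) in
  let P2 := P1 ++ map (shift_instr (size P1) (size P)) P in
  P2 ++ negate_at (size P2).

Lemma init_conc x : init x = conc 0 (size x :: nseq 19 0, nth 0 x).
Proof.
rewrite /init /conc; congr State; apply/funext => -[|i] //.
by have := nth_nseq 0 19 0 i; rewrite if_same => /= ->.
Qed.

(** [cP] is counted twice: for the run of [P], and as a bound on the growth of its answer register,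
    which the negation tests. *)
Lemma exec_compose P1 P B x y cP sP :
  (forall P2, exists2 c, c <= B & msteps (P1 ++ P2) (init x) c
     (State (size P1) (reg (init y)) (Defs.mem (init y)))) ->
  exec P (init y) cP sP ->
  let P2 := P1 ++ map (shift_instr (size P1) (size P)) P in
  exists c s, [/\ exec (P2 ++ negate_at (size P2)) (init x) c s,
    c <= B + 2 * cP + bits (size y) + 2 & accepting s <-> ~ accepting sP].
Proof.
move=> h eP P2; have [c1 c1B] := h (map (shift_instr (size P1) (size P)) P ++ negate_at (size P2)).
rewrite catA -/P2 => e1.
have e2 := msteps_shift P1 (negate_at (size P2)) eP.
rewrite catA -/P2 /shift_state min0n addn0 in e2.
have [c3 c3b [s e3 acc]] := exec_negate P2 sP.
have sP2 : size P2 = size P1 + size P by rewrite size_cat size_map.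
exists (c1 + (cP + c3)), s; split=> //.
  by apply: (msteps_exec e1); apply: (msteps_exec e2); rewrite -sP2.
have regP : bits (reg sP 0) <= bits (size y) + cP by exact: (exec_bits_reg 0 eP).
lia.
Qed.

Lemma exec_reduction conn P V T x y cP sP :
  runs V T (build_graph conn) (size x :: nseq 19 0, nth 0 x)
    (size y :: nseq 19 0, nth 0 y) ->
  exec P (init y) cP sP ->
  exists c s, [/\ exec (reduction conn P) (init x) c s,
    c <= T * unit_cost V + 2 * cP + bits (size y) + 2 & accepting s <-> ~ accepting sP].
Proof.
move=> build; apply: exec_compose => P2.
have [c cT e] := build [::] P2; exists c => //.
have iy := init_conc y; rewrite iy init_conc size_comp.
exact: e.
Qed.

(** * Size of the formula and cost of the reduction *)

Lemma size_clauses k (phi : kcnf k) : size (clauses phi) <= (nvars phi).*2.+1 ^ k.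
Proof.
set N := nvars phi.
(* A clause is padded to [k] optional literals, each with [2 * N + 1] possible values. *)
pose f (c : seq ('I_N * bool)) := [ffun i : 'I_k => onth c i].
have f_inj : {in clauses phi &, injective f}.
  move=> c d /(allP (clauses_size phi)) /andP[_ ck] /(allP (clauses_size phi)) /andP[_ dk].
  move=> /ffunP cd; apply: eq_from_onth_le => i; rewrite leq_max => ib.
  have ik : i < k by case/orP: ib => /leq_trans; apply.
  by have := cd (Ordinal ik); rewrite !ffunE.
have : uniq (map f (clauses phi)) by rewrite map_inj_in_uniq // clauses_uniq.
move=> /card_uniqP; rewrite size_map => <-; apply: leq_trans (max_card _) _.
by rewrite card_ffun card_option card_prod card_ord card_bool card_ord muln2.
Qed.

Lemma size_word k (phi : kcnf k) : size (word phi) <= k.+1 * (nvars phi).*2.+1 ^ k.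
Proof.
apply: (@leq_trans (k.+1 * size (clauses phi))); last by rewrite leq_mul2l size_clauses orbT.
have := clauses_size phi; rewrite /word; elim: (clauses phi) => //= c cs IH /andP[/andP[_ ck] /IH].
rewrite size_cat size_map mulnS => IH2; move: ck IH2.
by move: (size c) (size (flatten _)) (k.+1 * _) => a b d; lia.
Qed.

Lemma word_le k (phi : kcnf k) :
  all (leq^~ (2 * nvars phi + size (word phi))) (word phi).
Proof.
apply/allP => z /flatten_mapP[c cin]; rewrite inE => /orP[/eqP ->|/mapP[l lc ->]].
  apply: leq_trans (leq_addl _ _); rewrite /word; elim: (clauses phi) cin => //= d cs IH.
  rewrite size_cat size_map inE => /orP[/eqP ->|/IH]; lia.
apply: leq_trans (leq_addr _ _); rewrite /literal_code.
by case: l {lc} => v b /=; have := ltn_ord v; case: b => /=; lia.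
Qed.

Definition gadget_of (k : nat) (conn : bool) (phi : kcnf k) : tgraph :=
  gadget (size (word phi)) (2 ^ half phi) (falseA phi) (falseB phi) conn.

Definition gadget_word (k : nat) (conn : bool) (phi : kcnf k) : seq nat :=
  let K := size (word phi) in let n := 2 ^ half phi in
  code conn K (half phi) (K.+2 + n * K.+1.*2) (word phi) (verts K n).

Lemma gadget_word_enc k conn (phi : kcnf k) :
  tgraph_enc (gadget_of conn phi) (gadget_word conn phi).
Proof. by apply: tgraph_enc_triple; [exact: wf_triples | exact: uniq_triples]. Qed.

Lemma connected_unsat k (phi : kcnf k) m :
  temporally_connected m (gadget_of true phi) <-> ~ satisfiable phi.
Proof. by rewrite connected_gadget meet_unsat. Qed.

Lemma unilateral_unsat k (phi : kcnf k) m :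
  temporally_unilaterally_connected m (gadget_of false phi) <-> ~ satisfiable phi.
Proof. by rewrite unilateral_gadget meet_unsat. Qed.

(** For fixed [k], a polynomial in [N] that dominates the length of the word and [2 * N + 2]. *)
Definition poly_bound (k N : nat) : nat := k.+2 * (2 * N + 2) ^ k.+1.

Lemma poly_boundP k (phi : kcnf k) : let q := poly_bound k (nvars phi) in
  size (word phi) <= q /\ 2 * nvars phi + 2 <= q.
Proof.
have := size_word phi; rewrite /poly_bound; set N := nvars phi => wN.
have N0 : 0 < (2 * N + 2) ^ k by rewrite expn_gt0 addn2.
have b : (N.*2).+1 ^ k <= (2 * N + 2) ^ k.
  by case: (k) => // k'; rewrite leq_exp2r //; lia.
split; last by rewrite expnS; nia.
apply: leq_trans wN _; rewrite expnS; apply: leq_mul => //.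
by apply: leq_trans b _; rewrite leq_pmull // addn2.
Qed.

Lemma half_lt k (phi : kcnf k) : half phi < 2 ^ half phi.
Proof. exact: ltn_expl. Qed.

Lemma nvars_half k (phi : kcnf k) : nvars phi <= 2 * half phi <= (nvars phi).+1.
Proof. by rewrite /half uphalfE; move: (nvars phi) => N; lia. Qed.

(** With [n = 2 ^ half phi] and [q = poly_bound k N], building takes O(n q^2) units. A unit costs
    O(log (n q)), which is O(q) because [log n] is about [N / 2]. *)
Lemma reduction_time k conn (phi : kcnf k) x P cP sP :
  kcnf_enc phi x -> exec P (init (gadget_word conn phi)) cP sP ->
  exists c s, [/\ exec (reduction conn P) (init x) c s,
    c <= 2200 * (2 ^ half phi * poly_bound k (nvars phi) ^ 3) + 2 * cP
    & accepting s <-> ~ accepting sP].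
Proof.
move=> -> eP; rewrite -/(word phi).
have [] := poly_boundP phi; have := half_lt phi; have := nvars_half phi.
set N := nvars phi; set q := poly_bound k N; set h := half phi.
set K := size (word phi) => Nh hn Kq Nq.
pose n := 2 ^ h; pose nv := K.+2 + n * K.+1.*2; pose H := 16 * nv + 16.
have n0 : 0 < n by rewrite expn_gt0.
have nn : n <= nv by rewrite /nv; nia.
have nvq : nv <= 5 * (n * q) by rewrite /nv; nia.
have := @runs_build conn N K h n (2 * N + K) nv H (2 * H) (word phi)
  erefl erefl erefl erefl erefl erefl (word_le phi) (ltac:(lia)) (ltac:(lia)).
move=> build; have [c [s [e cb acc]]] := exec_reduction (x := N :: word phi)
  (y := gadget_word conn phi) build eP.
exists c, s; split=> //; apply: leq_trans cb _.
have sz : size (gadget_word conn phi) <= 15 * nv + 2.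
  have := size_code conn K h nv (word phi) (verts K n).
  by rewrite size_verts.
set T := n * _ + _ + _ + _; have TE : T <= 154 * (n * q ^ 2).
  have : n * (K * (4 * (2 * N + K) + 122) + 99) <= n * (94 * q ^ 2).
    by rewrite leq_mul2l; apply/orP; right; rewrite -mulnn; nia.
  have : q <= n * q by rewrite leq_pmull.
  have : n * q * 2 <= n * q ^ 2 by rewrite -mulnn mulnA leq_mul2l; lia.
  by rewrite /T; lia.
have UE : unit_cost (2 * H) <= 14 * q.
  have : 2 * H <= 176 * (n * q) by rewrite /H; nia.
  move/bits_mono; rewrite /unit_cost => b.
  have := bitsM 176 (n * q); have := bitsM n q; have := bits_le q.
  have : bits n = h.+1 by rewrite /bits /n trunc_expnK.
  have : bits 176 <= 8 by [].
  by lia.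
have := bits_le (size (gadget_word conn phi)).
have := leq_mul TE UE.
(* The gap between 2156 and 2200 absorbs [bits (size y) + 2] from [exec_reduction]. *)
have -> : 154 * (n * q ^ 2) * (14 * q) = 2156 * (n * q ^ 3) by rewrite [q ^ 3]expnSr; lia.
have : n * q * 4 <= n * q ^ 3.
  by rewrite -mulnA leq_mul2l [q ^ 3]expnS -mulnn leq_mul2l; nia.
have : 2 <= n * q by nia.
lia.
Qed.

Lemma reduction_decides k conn (yes : tgraph -> Prop) P :
  (forall phi : kcnf k, yes (gadget_of conn phi) <-> ~ satisfiable phi) ->
  decides tgraph_enc yes P ->
  decides (@kcnf_enc k) (@satisfiable k) (reduction conn P).
Proof.
move=> yesE dP phi x xphi; have [cP [sP [eP accP]]] := dP _ _ (gadget_word_enc conn phi).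
have [c [s [e _ acc]]] := reduction_time xphi eP.
exists c, s; split=> //; rewrite acc accP yesE; split=> [|sat /(_ sat)//].
exact: contrapT.
Qed.

(** Every vertex except [Hub] contributes one to five triples. The lower bound lets the number of
    temporal edges pass the threshold [M0]. *)
Lemma size_triples K n fA fB conn :
  n <= size (triples K n fA fB conn) <= 5 * (nverts' K n).+1.
Proof.
have uv : uniq (verts K n) by apply: (@map_uniq _ _ (num K)); rewrite num_verts iota_uniq.
have h (s : seq vert) : let t := size (flatten (map (triples_of K fA fB conn) s)) in
    size s <= t + count_mem Hub s /\ t <= 5 * size s.
  elim: s => //= v s [IH1 IH2]; rewrite size_cat size_map.
  by case: v => [||j|x|x|x j|x j] /=; case: conn IH1 IH2 => /= IH1 IH2; lia.
have [] := h (verts K n); rewrite (count_uniq_mem Hub uv) mem_verts size_verts /triples.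
rewrite /nverts' /=; nia.
Qed.

Lemma gadget_size k conn (phi : kcnf k) (G := gadget_of conn phi) :
  2 ^ half phi <= ntedges G /\
  ntedges G + nv G + life G <= 40 * (2 ^ half phi * poly_bound k (nvars phi)).
Proof.
have [] := poly_boundP phi; have := half_lt phi; rewrite /G /gadget_of.
set q := poly_bound _ _; set K := size (word phi); set n := 2 ^ _ => hn Kq Nq.
rewrite /gadget ntedges_triple; [|exact: wf_triples|exact: uniq_triples].
have := size_triples K n (falseA phi) (falseB phi) conn.
rewrite /= /nverts'; move: (size _) => M; nia.
Qed.

(** * Running times *)

Import Order.TTheory GRing.Theory Num.Theory.
Local Open Scope ring_scope.

Lemma powR2_ge1 (R : realType) (x : R) : 0 <= x -> 1 <= 2 `^ x :> R.
Proof. by move=> x0; rewrite -[leLHS](powRr0 (2 : R)) ler_powR // ler1n. Qed.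

(** From [1 + y <= expR y] at [y = g * N * ln 2]. *)
Lemma linear_le_powR2 (R : realType) (g : R) : 0 < g ->
  exists2 A : R, 0 < A & forall N : nat, N.+1%:R <= A * 2 `^ (g * N%:R).
Proof.
move=> g0; have l0 : 0 < ln 2 :> R by rewrite ln_gt0 // ltr1n.
have b0 : 0 < g * ln 2 by rewrite mulr_gt0.
exists (1 + (g * ln 2)^-1); first by rewrite addr_gt0 // invr_gt0.
move=> N; rewrite /powR pnatr_eq0 /=.
have E := expR_ge1Dx (g * N%:R * ln (2 : R)).
apply: le_trans (_ : (1 + (g * ln 2)^-1) * (1 + g * N%:R * ln 2) <= _); last first.
  by rewrite ler_wpM2l // addr_ge0 // invr_ge0 ltW.
have -> : (1 + (g * ln 2)^-1) * (1 + g * N%:R * ln 2) =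
    1 + N%:R + (g * ln 2) * N%:R + (g * ln 2)^-1.
  by field; rewrite !gt_eqF.
rewrite -natr1 [N%:R + 1]addrC -addrA lerDl addr_ge0 // ?invr_ge0 ?(ltW b0) //.
by rewrite mulr_ge0 // ltW.
Qed.

(** Induction on [D]: half of the exponent absorbs one factor, the other half the remaining
    power. *)
Lemma power_le_powR2 (R : realType) (D : nat) (g : R) : 0 < g ->
  exists2 A : R, 0 < A & forall N : nat, N.+1%:R ^+ D <= A * 2 `^ (g * N%:R).
Proof.
elim: D g => [|D IH] g g0.
  by exists 1 => // N; rewrite expr0 mul1r powR2_ge1 // mulr_ge0 // ltW.
have g2 : 0 < g / 2 by rewrite divr_gt0.
have [A A0 hA] := IH _ g2; have [B B0 hB] := linear_le_powR2 g2.
exists (B * A) => [|N]; first by rewrite mulr_gt0.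
rewrite exprS (_ : g * N%:R = g / 2 * N%:R + g / 2 * N%:R); last by field.
rewrite powRD ?pnatr_eq0 ?implybT // mulrACA.
by apply: ler_pM => //; rewrite ?exprn_ge0.
Qed.

Lemma poly_bound_le (R : realType) (k : nat) (g : R) : 0 < g ->
  exists2 A : R, 1 <= A & forall N : nat, (poly_bound k N)%:R <= A * 2 `^ (g * N%:R).
Proof.
move=> g0; have [A A0 hA] := power_le_powR2 k.+1 g0.
have c1 : 1 <= (k.+2 * 2 ^ k.+1)%N%:R :> R by rewrite ler1n muln_gt0 expn_gt0.
exists (1 + (k.+2 * 2 ^ k.+1)%N%:R * A) => [|N].
  by rewrite lerDl mulr_ge0 // ltW.
have -> : poly_bound k N = (k.+2 * 2 ^ k.+1 * N.+1 ^ k.+1)%N.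
  by rewrite /poly_bound -mulnA -expnMn mulnS addnC.
rewrite natrM natrX mulrDl -mulrA mul1r ler_wpDl ?powR_ge0 //.
by rewrite ler_wpM2l.
Qed.

Lemma ln_le_powR (R : realType) (x b : R) : 1 <= x -> 0 < b -> ln x <= x `^ b / b.
Proof.
move=> x1 b0; rewrite ler_pdivlMr // mulrC -ln_powR ltW // ln_sublinear //.
by rewrite powR_gt0 // (lt_le_trans ltr01).
Qed.

(** The logarithms use up half of [e]: [ln X] is at most [X ^ b / b], and [b] is chosen such that
    [b * d <= e / 2]. One [X] bounds both the number of temporal edges and the argument of the
    logarithm. *)
Lemma softO_le (R : realType) (C a e : R) (d : nat) : 0 < e <= 1 -> a <= 2 - e ->
  exists2 C' : R, 0 <= C' & forall M y X : R, 1 <= M <= X -> 1 <= y <= X ->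
    C * M `^ a * ln y ^+ d <= C' * X `^ (2 - e / 2).
Proof.
case/andP=> e0 e1 ae; pose b := e / (2 * d.+1%:R).
have b0 : 0 < b by rewrite divr_gt0 // mulr_gt0.
exists (`|C| * b^-1 ^+ d) => [|M y X /andP[M1 MX] /andP[y1 yX]].
  by rewrite mulr_ge0 // exprn_ge0 // invr_ge0 ltW.
have X1 := le_trans M1 MX.
have X0 := lt_le_trans ltr01 X1; have M0 := lt_le_trans ltr01 M1.
have y0 := lt_le_trans ltr01 y1.
have lny0 : 0 <= ln y by rewrite ln_ge0.
have ML : 0 <= M `^ a * ln y ^+ d by rewrite mulr_ge0 ?powR_ge0 // exprn_ge0.
rewrite -mulrA; apply: le_trans (ler_wpM2r ML (ler_norm C)) _.
rewrite -[leRHS]mulrA ler_wpM2l //.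
apply: le_trans (_ : X `^ (2 - e) * (X `^ b / b) ^+ d <= _).
  apply: ler_pM; rewrite ?powR_ge0 ?exprn_ge0 //.
    apply: le_trans (_ : M `^ (2 - e) <= _); first exact: ler_powR.
    by apply: ge0_ler_powR; rewrite ?nnegrE //; lra.
  apply: lerXn2r; rewrite ?nnegrE //; first by rewrite divr_ge0 ?powR_ge0 // ltW.
  by apply: le_trans (ln_le_powR X1 b0); rewrite ler_ln ?posrE.
rewrite exprMn mulrA [leRHS]mulrC ler_wpM2r ?exprn_ge0 ?invr_ge0 ?(ltW b0) //.
rewrite -powR_mulrn ?powR_ge0 // -powRrM -powRD; last by rewrite (gt_eqF X0) implybT.
apply: ler_powR => //.
have : b * d%:R <= e / 2.
  rewrite /b -mulrA ler_wpM2l ?(ltW e0) // invfM -mulrA ler_piMr ?invr_ge0 //.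
  by rewrite mulrC ler_pdivrMr // mul1r ler_nat.
lra.
Qed.

(** The graph has size X = O(2^((1/2 + e/16) N)), where e/16 absorbs the polynomial in [N]. Both the
    construction and the assumed algorithm, in time O(X^(2 - e/2)), stay within 2^((1 - e/8) N). *)
Lemma ksat_solvable_of_softO (R : realType) (k : nat) (conn : bool)
    (yes : tgraph -> Prop) (eps : R) (e := Num.min eps 1) : 0 < eps ->
  (forall phi : kcnf k, yes (gadget_of conn phi) <-> ~ satisfiable phi) ->
  solvable_in_softO yes (2 - eps) -> ksat_solvable k (e / 8).
Proof.
move=> eps0 yesE [P [dP [C [d [M0 tP]]]]].
exists (reduction conn P); split; first exact: reduction_decides dP.
have e0 : 0 < e by rewrite lt_min eps0 ltr01.
have e1 : e <= 1 by rewrite ge_min lexx orbT.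
have eeps : e <= eps by rewrite ge_min lexx.
have g0 : 0 < e / 16 by rewrite divr_gt0.
have [A A1 hA] := poly_bound_le k g0.
have A0 := lt_le_trans ltr01 A1.
have ae : 2 - eps <= 2 - e by lra.
have e01 : 0 < e <= 1 by rewrite e0.
have [C' C'0 hC'] := softO_le C d e01 ae.
(* From [2 * M0 <= N] follows [M0 <= half phi], hence enough temporal edges. *)
exists (2200 * (2 * A ^+ 3) + 2 * (C' * (80 * A) `^ (2 - e / 2))), (2 * M0)%N.
move=> phi x c s xphi ex; set N := nvars phi => NM0.
have [cP [sP [eP _]]] := dP _ _ (gadget_word_enc conn phi).
have [c' [s' [ex' cb _]]] := reduction_time xphi eP.
have [-> _] := exec_det ex ex'.
have [nM MX] := gadget_size conn phi.
have hM0 : (M0 <= ntedges (gadget_of conn phi))%N.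
  by have := nvars_half phi; have := half_lt phi; rewrite -/N; lia.
have cPb := tP _ _ _ _ (gadget_word_enc conn phi) eP hM0.
set M := ntedges _ in nM MX hM0 cPb; set n := (2 ^ half phi)%N in nM MX cb.
set q := poly_bound k (nvars phi) in MX cb.
have n1 : (0 < n)%N by rewrite expn_gt0.
have nb : n%:R <= 2 * 2 `^ (2^-1 * N%:R) :> R.
  rewrite natrX -powR_mulrn // -[X in X * _](powRr1 (ler0n _ 2)) -powRD ?pnatr_eq0 ?implybT //.
  apply: ler_powR; first by rewrite ler1n.
  have := nvars_half phi; rewrite -/N => /andP[_].
  rewrite -(ler_nat R) natrM -[N.+1%:R]natr1; lra.
have qb : q%:R <= A * 2 `^ (e / 16 * N%:R) by exact: hA.
(* 80 is the 40 of [gadget_size] times the 2 lost by rounding [N / 2] up. *)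
pose X : R := 80 * A * 2 `^ ((2^-1 + e / 16) * N%:R).
have XE : X = 40 * (2 * 2 `^ (2^-1 * N%:R)) * (A * 2 `^ (e / 16 * N%:R)).
  rewrite /X (mulrDl 2^-1) powRD ?pnatr_eq0 ?implybT //; ring.
have MXR : (M + nv (gadget_of conn phi) + life (gadget_of conn phi))%:R <= X.
  apply: le_trans (_ : (40 * (n * q))%:R <= _); first by rewrite ler_nat.
  rewrite XE natrM natrM -[leRHS]mulrA ler_wpM2l //; exact: ler_pM.
have MR : (1 : R) <= M%:R <= X.
  rewrite ler1n (leq_trans n1 nM) /=; apply: le_trans MXR.
  by rewrite ler_nat -addnA leq_addr.
have yR : (1 : R) <= (M + nv (gadget_of conn phi) + life (gadget_of conn phi))%:R <= X.
  by rewrite MXR andbT ler1n addnS.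
have {}cPb := le_trans cPb (hC' _ _ _ MR yR).
have N0 : 0 <= N%:R :> R by [].
have pre : (n * q ^ 3)%:R <= 2 * A ^+ 3 * 2 `^ ((1 - e / 8) * N%:R).
  rewrite natrM natrX.
  apply: le_trans (_ : 2 * 2 `^ (2^-1 * N%:R) * (A * 2 `^ (e / 16 * N%:R)) ^+ 3 <= _).
    apply: ler_pM; rewrite ?exprn_ge0 //.
    by apply: lerXn2r; rewrite ?nnegrE ?mulr_ge0 ?powR_ge0 ?(ltW A0).
  rewrite exprMn mulrACA ler_wpM2l ?mulr_ge0 ?exprn_ge0 ?(ltW A0) //.
  rewrite -powR_mulrn ?powR_ge0 // -powRrM -powRD ?pnatr_eq0 ?implybT //.
  apply: ler_powR; first by rewrite ler1n.
  (* 1/2 + 3e/16 <= 1 - e/8, since e <= 1. *)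
  rewrite [e / 16 * _ * _]mulrAC -mulrDl ler_wpM2r //; lra.
have post : C' * X `^ (2 - e / 2) <= C' * (80 * A) `^ (2 - e / 2) * 2 `^ ((1 - e / 8) * N%:R).
  rewrite -mulrA ler_wpM2l // /X powRM ?powR_ge0 ?mulr_ge0 ?(ltW A0) //.
  rewrite ler_wpM2l ?powR_ge0 // -powRrM; apply: ler_powR; first by rewrite ler1n.
  (* (1/2 + e/16)(2 - e/2) = 1 - e/8 - e^2/32. *)
  rewrite mulrAC ler_wpM2r //; nra.
have {}cb : c'%:R <= 2200 * (n * q ^ 3)%:R + 2 * cP%:R :> R.
  by rewrite -!natrM -natrD ler_nat.
move: cb pre post cPb; lra.
Qed.

Theorem theorem9 (R : realType) :
  SETH R ->
  forall (m : model) (eps : R), 0 < eps ->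
    ~ solvable_in_softO (temporally_connected m) (2 - eps) /\
    ~ solvable_in_softO (temporally_unilaterally_connected m) (2 - eps).
Proof.
move=> seth m eps eps0.
(* The exponent gain depends on [eps] only, so it can be fixed before SETH supplies [k]. *)
have [|k nk] := seth (Num.min eps 1 / 8); first by rewrite divr_gt0 // lt_min eps0 ltr01.
split=> so; apply: nk.
  by apply: (ksat_solvable_of_softO eps0 _ so) => phi; exact: connected_unsat.
by apply: (ksat_solvable_of_softO eps0 _ so) => phi; exact: unilateral_unsat.
Qed.
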